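(* (i) The polyhedral cone in $\mathbb{R}^n$ given by the logarithms of Hutchinson's inequalities $$\frac{a_i^2}{a_{i-1}a_{i+1}}\ge 4,\qquad i=1,\dots,n-1$$ (i.e. the cone coinciding with the logarithmic image of the set of two-sided truncation hyperbolic polynomials) is the maximal polyhedral cone contained in $L\Delta_n$. The same cone is the maximal polyhedral cone contained in $L\Sigma_n$. (ii) The minimal polyhedral cone containing $L\Delta_n$ is given by the logarithms of Petrovitch's inequalities $$\frac{a_i^2}{a_{i-1}a_{i+1}}\ge m_i,\qquad i=1,\dots,n-1,$$ while the minimal polyhedral cone containing $L\Sigma_n$ is given by the logarithms of Newton's inequalities $$\frac{a_i^2}{a_{i-1}a_{i+1}}\ge\frac{(n-i+1)(i+1)}{(n-i)i},\qquad i=1,\dots,n-1.$$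
   Context: A real polynomial is called hyperbolic if all its roots are real. Let $Pol_n$ be the space of monic real polynomials $P(x)=x^n+a_1x^{n-1}+\dots+a_n$, with the convention $a_0=1$. $\Sigma_n\subset Pol_n$ is the set of polynomials all of whose roots are real and negative. $\Delta_n\subset Pol_n$ is the set of reverted section-hyperbolic polynomials: all $a_i>0$ and for every $i=1,\dots,n$ the section $x^n+a_1x^{n-1}+\dots+a_ix^{n-i}$ is hyperbolic. A polynomial with positive coefficients is two-sided truncation hyperbolic if every finite segment of it (the sum of the terms with degrees between any two given degrees) is hyperbolic. $L\Delta_n,L\Sigma_n\subset\mathbb{R}^n$ are the images of $\Delta_n,\Sigma_n$ under $(a_1,\dots,a_n)\mapsto(\log a_1,\dots,\log a_n)$. Taking logarithms turns each of the displayed systems of inequalities into a system of (affine) linear inequalities in $\log a_1,\dots,\log a_n$. A polyhedral cone here may have its apex anywhere (a translate of a polyhedral cone with apex at the origin); maximal and minimal are with respect to inclusion. For a positive integer $i$, $m_i=\inf\frac{a_i^2}{a_{i-1}a_{i+1}}$, the infimum being over all reverted section-hyperbolic polynomials of all degrees at least $i+1$ (equivalently, over $\Delta_{i+1}$). *)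

(* Defs.v *)
From HB Require Import structures.
From mathcomp Require Import all_boot all_order all_algebra.
From mathcomp Require Import all_classical all_reals all_analysis.
From mathcomp Require Import complex.

Set Implicit Arguments.
Unset Strict Implicit.
Unset Printing Implicit Defensive.

Import Order.TTheory GRing.Theory Num.Theory.

Local Open Scope classical_set_scope.
Local Open Scope ring_scope.

Section Polynomials.
Variable R : realType.
Implicit Types (n i j k : nat) (P : {poly R}).

(* "All roots are real" is a condition on the complex roots. Nonzero constants
   have no root, hence are hyperbolic. *)
Definition hyperbolic P : Prop :=
  forall z : R[i], root (map_poly (real_complex R) P) z -> complex.Im z = 0.

Definition Pol n : set {poly R} := [set P | P \is monic /\ size P = n.+1].

(* For P in Pol n and i <= n, this is the coefficient a_i in
   P = x^n + a_1 x^(n-1) + ... + a_n; in particular a_0 = 1. *)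
Definition acoef n P i : R := P`_(n - i).

Definition segment j k P : {poly R} := \sum_(j <= d < k.+1) P`_d *: 'X^d.

Definition Sigma n : set {poly R} :=
  [set P | [/\ Pol n P, hyperbolic P & forall x : R, root P x -> x < 0]].

Definition poscoef n P : Prop :=
  forall i, (0 < i <= n)%N -> 0 < acoef n P i.

(* The section x^n + a_1 x^(n-1) + ... + a_i x^(n-i) consists of the terms of
   degrees between n - i and n. *)
Definition Delta n : set {poly R} :=
  [set P | [/\ Pol n P, poscoef n P &
    forall i, (0 < i <= n)%N -> hyperbolic (segment (n - i) n P)]].

Definition two_sided n : set {poly R} :=
  [set P | [/\ Pol n P, poscoef n P &
    forall j k, (j <= k <= n)%N -> hyperbolic (segment j k P)]].

Definition coef_ratio n P i : R :=
  acoef n P i ^+ 2 / (acoef n P i.-1 * acoef n P i.+1).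

(* The constant m_i, for i > 0. *)
Definition petrovitch i : R :=
  inf [set r | exists k P, [/\ (i < k)%N, Delta k P & r = coef_ratio k P i]].

Definition newton n i : R :=
  ((n - i + 1) * (i + 1))%:R / ((n - i) * i)%:R.

(* The log-image in R^n; coordinates are 0-based, so that log a_i is stored at
   index i - 1. *)
Definition logvec n P : 'rV[R]_n := \row_(j < n) ln (acoef n P j.+1).

Definition logimage n (S : set {poly R}) : set 'rV[R]_n := logvec n @` S.

End Polynomials.

Section Cones.
Variable R : realType.
Implicit Types (n : nat).

(* The coordinate "log a_i" of x, for 0 <= i <= n, with log a_0 = log 1 = 0. *)
Definition logcoord n (x : 'rV[R]_n) (i : nat) : R :=
  if i is j.+1 then oapp (x 0) 0 (insub j : option 'I_n) else 0.

(* The logarithmic form of the inequalities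
   a_i^2 / (a_(i-1) a_(i+1)) >= c_i for i = 1, ..., n-1. *)
Definition ratio_cone n (c : nat -> R) : set 'rV[R]_n :=
  [set x | forall i, (0 < i < n)%N ->
     ln (c i) <= 2 * logcoord x i - logcoord x i.-1 - logcoord x i.+1].

Definition polyhedral_cone n (C : set 'rV[R]_n) : Prop :=
  exists (m : nat) (A : 'M[R]_(m, n)) (v : 'rV[R]_n),
    C = [set x | forall k, 0 <= (A *m (x - v)^T) k 0].

Definition maximal_cone_in n (S C : set 'rV[R]_n) : Prop :=
  [/\ polyhedral_cone C, C `<=` S &
    forall D, polyhedral_cone D -> D `<=` S -> C `<=` D -> D = C].

Definition minimal_cone_containing n (S C : set 'rV[R]_n) : Prop :=
  [/\ polyhedral_cone C, S `<=` C &
    forall D, polyhedral_cone D -> S `<=` D -> D `<=` C -> D = C].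

End Cones.

Arguments Sigma : clear implicits.
Arguments Delta : clear implicits.
Arguments two_sided : clear implicits.
Arguments petrovitch : clear implicits.
Arguments newton : clear implicits.

(* Main.v *)
Require Import Defs.
From mathcomp Require Import all_boot all_order all_algebra.
From mathcomp Require Import all_classical all_reals all_analysis.
From mathcomp Require Import complex polyrcf ring lra zify.

Set Implicit Arguments.
Unset Strict Implicit.
Unset Printing Implicit Defensive.

Import Order.TTheory GRing.Theory Num.Theory.

Local Open Scope classical_set_scope.
Local Open Scope ring_scope.

(** Write q_i(x) = 2 x_i - x_(i-1) - x_(i+1) (with x_0 = 0) for the logarithm
    of the i-th coefficient ratio; it is called concavity below.  Every cone
    ratio_cone c is a translate of the recession cone K = {y | q_i(y) >= 0 for
    0 < i < n}, since the system q_i(x) = ln c_i is solvable.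

    Hutchinson's cone is the log-image of the two-sided truncation hyperbolic
    polynomials.  Segments of length three give the inequalities.  Conversely,
    if p_d are positive and p_d^2 >= 4 p_(d-1) p_(d+1), then at
    -2 p_(k-1) / p_k the term of degree k dominates its two alternating tails.
    Together with the value at 0 this yields as many sign changes as the degree,
    except in degree 2, where the discriminant decides
    ([hyperbolic_hutchinson]).

    Maximality.  Let D be a polyhedral cone with Hutchinson's cone inside D
    and D inside the log-image of Sigma_n.  Then K is contained in the
    recession cone of D.  If x is in D and q_i(x) < ln 4, the trinomial made of
    the terms around a_i has a nonreal root z, and moving x along a direction of
    K multiplies the other terms by small factors.  The resulting polynomial P is
    hyperbolic with negative roots, so that |P(z)| >= k^n P(|z|) for a constant
    k > 0 depending only on z, whereas |P(z)| is arbitrarily small compared to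
    P(|z|) ([damped_not_hyperbolic]).  The case of Delta_n follows because
    Delta_n is contained in Sigma_n.

    Minimality ([minimal_ratio_cone]).  If a polyhedral cone D lies between S
    and ratio_cone c, and S contains Hutchinson's cone, the recession cone of D
    is exactly K, so D is given by the inequalities q_i(x) >= q_i(v), with v its
    apex.  Hence D is the whole of ratio_cone c as soon as ln c_i is the infimum
    of q_i over S for each i separately.  For Sigma_n this is Newton's
    inequality, attained by (x + 1)^n.  For Delta_n the constant m_i is an
    infimum over all degrees, and it has to be approached inside Delta_n
    ([Delta_ratio_lt]): truncate a near-minimizer to degree i + 1, decrease its
    constant coefficient slightly, which makes all its roots simple, and then
    append small coefficients one at a time. *)

(** * Split polynomials, hyperbolic polynomials and logarithmic derivatives *)

Section LogDerivative.
Variable F : fieldType.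
Implicit Types (s : seq F) (c r : F).

(** The monic polynomial with root sequence [s], with multiplicities. *)
Definition split_poly s : {poly F} := \prod_(r <- s) ('X - r%:P).

Lemma split_poly_cons r s : split_poly (r :: s) = ('X - r%:P) * split_poly s.
Proof. by rewrite /split_poly big_cons. Qed.

Lemma split_poly_deriv s c : c \notin s ->
  (split_poly s)^`().[c] = (split_poly s).[c] * \sum_(r <- s) (c - r)^-1.
Proof.
elim: s => [|r s IH].
  by rewrite /split_poly !big_nil derivC horner0 mulr0.
rewrite inE negb_or => /andP[cr cs]; rewrite split_poly_cons big_cons.
rewrite derivM derivXsubC !hornerE IH //.
have : c - r != 0 by rewrite subr_eq0.
by move=> h; field.
Qed.

Lemma split_poly_deriv2 s c : c \notin s ->
  (split_poly s)^`()^`().[c] = (split_poly s).[c] *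
    ((\sum_(r <- s) (c - r)^-1) ^+ 2 - \sum_(r <- s) (c - r)^-1 ^+ 2).
Proof.
elim: s => [|r s IH].
  by rewrite /split_poly !big_nil derivC deriv0 horner0 expr0n subrr mulr0.
rewrite inE negb_or => /andP[cr cs]; rewrite split_poly_cons !big_cons.
rewrite derivM derivXsubC mul1r derivD derivM derivXsubC mul1r.
rewrite !(hornerXsubC, hornerD, hornerM) IH // split_poly_deriv //.
have : c - r != 0 by rewrite subr_eq0.
by move=> h; field.
Qed.

Lemma split_poly_simple s :
  (forall c, root (split_poly s) c -> (split_poly s)^`().[c] != 0) -> uniq s.
Proof.
elim: s => [//|r s IH] H; rewrite cons_uniq; apply/andP; split.
  apply/negP => rs; have := H r.
  rewrite /root split_poly_cons derivM derivXsubC !hornerE subrr !mul0r.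
  rewrite eqxx => /(_ isT); suff -> : (split_poly s).[r] = 0 by rewrite addr0 eqxx.
  by apply/eqP; rewrite -[_ == 0]/(root _ _) root_prod_XsubC.
apply: IH => c rc; apply/eqP => dc.
have := H c; rewrite /root split_poly_cons derivM derivXsubC !hornerE.
by rewrite (eqP rc) dc !mulr0 addr0 eqxx => /(_ isT).
Qed.

End LogDerivative.

Section Hyperbolic.
Variable R : realType.
Implicit Types (P Q : {poly R}) (s : seq R) (z : R[i]) (a b c x r : R).
Local Notation toC := (real_complex R).
Local Notation Im := (@complex.Im R).

Lemma Im_sum (I : Type) (s : seq I) (f : I -> R[i]) :
  Im (\sum_(i <- s) f i) = \sum_(i <- s) Im (f i).
Proof.
elim: s => [|i s IH]; first by rewrite !big_nil.
rewrite !big_cons -IH.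
by case: (f i) (\sum_(j <- s) f j) => [? ?] [? ?].
Qed.

Lemma Im_scale a z : Im (toC a * z) = a * Im z.
Proof. by case: z => x y /=; rewrite mul0r addr0. Qed.

Lemma map_split_poly s :
  map_poly toC (split_poly s) = split_poly (map toC s).
Proof.
rewrite /split_poly rmorph_prod big_map; apply: eq_bigr => r _.
by rewrite rmorphB /= map_polyX map_polyC.
Qed.

Lemma hyperbolic_split P : P != 0 -> hyperbolic P ->
  exists s, P = lead_coef P *: split_poly s.
Proof.
move=> P0 hP; have [zs E] := closed_field_poly_normal (map_poly toC P).
have real z : z \in zs -> z = toC (complex.Re z).
  move=> zin; have /hP : root (map_poly toC P) z.
    by rewrite E rootZ ?lead_coef_map ?fmorph_eq0 ?lead_coef_eq0 ?root_prod_XsubC.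
  by case: z {zin} => x y /= ->.
exists (map (@complex.Re R) zs); apply: (map_poly_inj (@real_complex R)).
rewrite map_polyZ map_split_poly [LHS]E lead_coef_map; congr (_ *: _).
rewrite /split_poly -map_comp big_map big_seq [RHS]big_seq.
by apply: eq_bigr => z zin /=; rewrite -real.
Qed.

Lemma split_hyperbolic a s : a != 0 -> hyperbolic (a *: split_poly s).
Proof.
move=> a0 z; rewrite map_polyZ map_split_poly rootZ ?fmorph_eq0 //.
by rewrite root_prod_XsubC => /mapP[r _ ->].
Qed.

Lemma hyperbolic_neq0 P : hyperbolic P -> P != 0.
Proof.
move=> hP; apply/eqP => P0; have := hP ('i%C); rewrite P0 rmorph0 root0 /=.
by move=> /(_ isT) /eqP; rewrite oner_eq0.
Qed.

Lemma hyperbolicC a : a != 0 -> hyperbolic a%:P.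
Proof.
move=> a0; have := @split_hyperbolic a [::] a0.
by rewrite /split_poly big_nil alg_polyC.
Qed.

Lemma hyperbolicM P Q : hyperbolic (P * Q) <-> hyperbolic P /\ hyperbolic Q.
Proof.
rewrite /hyperbolic; split=> [H|[HP HQ]].
  by split=> z h; apply: H; rewrite rmorphM rootM h ?orbT.
by move=> z; rewrite rmorphM rootM => /orP[/HP|/HQ].
Qed.

Lemma hyperbolicX : hyperbolic ('X : {poly R}).
Proof. by move=> z; rewrite map_polyX rootX => /eqP->. Qed.

Lemma hyperbolicXn k : hyperbolic ('X^k : {poly R}).
Proof.
elim: k => [|k IH]; first by apply: hyperbolicC; rewrite oner_eq0.
by rewrite exprS; apply/hyperbolicM; split=> //; exact: hyperbolicX.
Qed.

Lemma hyperbolicXnM k P : hyperbolic ('X^k * P) <-> hyperbolic P.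
Proof.
by split=> [/hyperbolicM[]//|h]; apply/hyperbolicM; split=> //; exact: hyperbolicXn.
Qed.

Lemma hyperbolicZ a P : a != 0 -> hyperbolic (a *: P) <-> hyperbolic P.
Proof.
move=> a0; rewrite -mul_polyC; split=> [/hyperbolicM[]//|h].
by apply/hyperbolicM; split=> //; apply: hyperbolicC.
Qed.

Lemma Im_invBr z r : Im z != 0 ->
  exists2 a, 0 < a & Im ((z - toC r)^-1) = - (Im z * a).
Proof.
case: z => x y /= y0.
exists (((x - r) ^+ 2 + (y + - 0) ^+ 2)^-1).
  by rewrite invr_gt0 subr0 ltr_wpDl ?sqr_ge0 // exprn_even_gt0.
by rewrite !subr0.
Qed.

(** Off the real axis, the imaginary part of P' / P = sum 1 / (z - r) has the
    sign opposite to that of Im z, since every summand has. *)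
Lemma hyperbolic_deriv_nonreal P z : (1 < size P)%N -> hyperbolic P ->
  Im z != 0 ->
  exists2 w : R[i], Im z * Im w < 0 &
    (map_poly toC P)^`().[z] = (map_poly toC P).[z] * w.
Proof.
move=> sP hP z0; have P0 : P != 0 by rewrite -size_poly_gt0 ltnW.
have [s E] := hyperbolic_split P0 hP.
have zs : z \notin map toC s by apply/mapP => -[r _ zr]; rewrite zr eqxx in z0.
exists (\sum_(r <- map toC s) (z - r)^-1); last first.
  rewrite E map_polyZ map_split_poly derivZ !hornerZ split_poly_deriv //.
  by rewrite mulrA.
have s0 : s != [::].
  apply/eqP => s0; move: sP; rewrite E s0 /split_poly big_nil size_scale.
    by rewrite size_poly1.
  by rewrite lead_coef_eq0.
rewrite Im_sum big_map mulr_sumr; case: s s0 {E zs} => [//|r s _].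
(* every summand contributes negatively, and there is at least one *)
have neg x : Im z * Im ((z - toC x)^-1) < 0.
  have [a a0 ->] := Im_invBr x z0.
  by rewrite mulrN oppr_lt0 mulrA mulr_gt0 // -expr2 exprn_even_gt0.
rewrite big_cons; apply: ltr_wnDr => //.
by apply: sumr_le0 => x _; apply/ltW.
Qed.

(** Gauss-Lucas, for hyperbolic polynomials. *)
Lemma hyperbolic_deriv P : (1 < size P)%N -> hyperbolic P -> hyperbolic P^`().
Proof.
move=> sP hP z rz; apply/eqP/negP => /negP z0.
have [w zw] := hyperbolic_deriv_nonreal sP hP z0.
move: rz; rewrite /root -deriv_map => /eqP -> /esym /eqP.
rewrite mulf_eq0 => /orP[rP|/eqP w0]; last by rewrite w0 mulr0 ltxx in zw.
by move: z0; rewrite hP ?eqxx.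
Qed.

(** Here S1 and S2 are the sums of 1 / (c - r) and 1 / (c - r)^2 over the
    roots, and the inequality is Cauchy-Schwarz. *)
Lemma hyperbolic_log_deriv P c : hyperbolic P -> P.[c] != 0 ->
  exists S1 S2, [/\ P^`().[c] = P.[c] * S1,
    P^`()^`().[c] = P.[c] * (S1 ^+ 2 - S2),
    S1 ^+ 2 <= (size P).-1%:R * S2 & (1 < size P)%N -> 0 < S2].
Proof.
move=> hP Pc; have P0 := hyperbolic_neq0 hP.
have l0 : lead_coef P != 0 by rewrite lead_coef_eq0.
have [s E] := hyperbolic_split P0 hP.
have sz : size P = (size s).+1 by rewrite E size_scale // size_prod_XsubC.
have cs : c \notin s.
  apply: contra Pc => cs; rewrite -[_ == _]/(root P c) E rootZ //.
  by rewrite root_prod_XsubC.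
exists (\sum_(r <- s) (c - r)^-1), (\sum_(r <- s) (c - r)^-1 ^+ 2).
rewrite sz /=; split.
- by rewrite E derivZ !hornerZ split_poly_deriv // mulrA.
- by rewrite E !derivZ !hornerZ split_poly_deriv2 // mulrA.
- elim: s {E sz cs} => [|r s IH]; first by rewrite !big_nil expr0n mul0r.
  rewrite !big_cons /=.
  set u := (c - r)^-1; set S1 := \sum_(r <- s) _; set S2 := \sum_(r <- s) _.
  have S20 : 0 <= S2 by apply: sumr_ge0 => x _; apply: sqr_ge0.
  (* sum over the other roots of 2 u v <= u^2 + v^2 *)
  have key : 2 * u * S1 <= (size s)%:R * u ^+ 2 + S2.
    rewrite /S1 /S2; elim: (s) => [|x t IHt].
      by rewrite !big_nil mul0r mulr0 addr0.
    rewrite !big_cons /= -natr1.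
    have := sqr_ge0 (u - (c - x)^-1); lra.
  rewrite -natr1; rewrite -/S1 -/S2 in IH; nra.
- case: s {E sz} cs => [//|r s]; rewrite inE negb_or => /andP[cr _] _.
  rewrite big_cons ltr_pwDl //; last by apply: sumr_ge0 => x _; apply: sqr_ge0.
  by rewrite exprn_even_gt0 // invr_eq0 subr_eq0.
Qed.

End Hyperbolic.

(** * Pencils of hyperbolic polynomials and sign alternation *)

Section Alternation.
Variable R : realType.
Implicit Types (P Q : {poly R}) (s : seq R) (z : R[i]) (a b c x r : R).
Local Notation toC := (real_complex R).
Local Notation Im := (@complex.Im R).

Lemma size_polyDC P a : (1 < size P)%N -> size (P + a%:P) = size P.
Proof.
move=> sP; rewrite size_polyDl // size_polyC.
by apply: leq_ltn_trans sP; case: eqP.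
Qed.

(** At a nonreal root of P + a, the logarithmic derivatives of P and P + b are
    P' / (- a) and P' / (b - a), so their imaginary parts have opposite signs. *)
Lemma hyperbolic_between P a b : (1 < size P)%N ->
  hyperbolic P -> hyperbolic (P + b%:P) -> 0 < a < b -> hyperbolic (P + a%:P).
Proof.
move=> sP hP hPb /andP[a0 ab] z rz; apply/eqP/negP => /negP z0.
have Pz : (map_poly toC P).[z] = toC (- a).
  move: rz; rewrite /root rmorphD /= map_polyC hornerD hornerC addr_eq0 => /eqP ->.
  by rewrite rmorphN.
have sPb : (1 < size (P + b%:P)%R)%N by rewrite size_polyDC.
have [w zw dw] := hyperbolic_deriv_nonreal sP hP z0.
have [w' zw' dw'] := hyperbolic_deriv_nonreal sPb hPb z0.
have : Im (toC (- a) * w) = Im (toC (b - a) * w').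
  have Pbz : (map_poly toC (P + b%:P)).[z] = toC (b - a).
    by rewrite rmorphD /= map_polyC hornerD hornerC Pz -rmorphD addrC.
  rewrite -Pbz -dw' -Pz -dw rmorphD /= map_polyC derivD derivC addr0.
  by [].
rewrite !Im_scale => h.
have : Im z * (- a * Im w) = Im z * ((b - a) * Im w') by rewrite h.
have := mulr_gt0 a0 (_ : 0 < - (Im z * Im w)); rewrite oppr_gt0 => /(_ zw).
have ba : 0 < b - a by rewrite subr_gt0.
have := mulr_gt0 ba (_ : 0 < - (Im z * Im w')); rewrite oppr_gt0 => /(_ zw').
move=> *; lra.
Qed.

(** At a double root c of P + a the quantity P(c) P''(c) would be negative for
    both P and P + b, whose values - a and b - a at c have opposite signs. *)
Lemma simple_between P a b c : (1 < size P)%N ->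
  hyperbolic P -> hyperbolic (P + b%:P) -> 0 < a < b ->
  root (P + a%:P) c -> (P + a%:P)^`().[c] != 0.
Proof.
move=> sP hP hPb /andP[a0 ab]; rewrite /root hornerD hornerC => /eqP rc.
have sPb : (1 < size (P + b%:P)%R)%N by rewrite size_polyDC.
have Pc : P.[c] = - a by lra.
have Pbc : (P + b%:P).[c] = b - a by rewrite hornerD hornerC; lra.
have ba0 : b - a != 0 by rewrite subr_eq0 gt_eqF.
have na0 : - a != 0 by rewrite oppr_eq0 gt_eqF.
have [|S1 [S2 [d1 d2 _ /(_ sP) S20]]] := @hyperbolic_log_deriv _ P c hP.
  by rewrite Pc.
have [|T1 [T2 [e1 e2 _ /(_ sPb) T20]]] := @hyperbolic_log_deriv _ _ c hPb.
  by rewrite Pbc.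
rewrite Pc in d1 d2; rewrite Pbc in e1 e2.
rewrite derivD derivC addr0; apply/eqP => dc.
rewrite !(derivD, derivC) ?addr0 in e1 e2.
have S10 : S1 = 0.
  by apply/eqP; rewrite -(mulrI_eq0 _ (lregP na0)) -d1 dc.
have T10 : T1 = 0.
  by apply/eqP; rewrite -(mulrI_eq0 _ (lregP ba0)) -e1 dc.
have := mulr_gt0 a0 S20.
have := mulr_gt0 (_ : 0 < b - a) T20; rewrite subr_gt0 => /(_ ab).
rewrite S10 in d2; rewrite T10 in e2; move=> *; nra.
Qed.

(** [P] takes alternating strict signs at the decreasing points t_0, ..., t_n,
    beginning with a positive value at t_0. *)
Definition alternates n P (t : nat -> R) : Prop :=
  (forall k, (k < n)%N -> t k.+1 < t k) /\
  (forall k, (k <= n)%N -> 0 < (-1) ^+ k * P.[t k]).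

Lemma alternates_le n P t k l : alternates n P t -> (k <= l <= n)%N ->
  t l <= t k.
Proof.
move=> [dec _] /andP[kl]; elim: l kl => [|l IH] kl ln.
  by move: kl; rewrite leqn0 => /eqP ->.
move: kl; rewrite leq_eqVlt => /orP[/eqP -> //|kl].
by rewrite (le_trans (ltW (dec l ln))) // IH // ltnW.
Qed.

Lemma alternates_hyperbolic n P t :
  size P = n.+1 -> alternates n P t -> hyperbolic P.
Proof.
move=> sP alt; have [dec sgn] := alt.
have H k : exists r, (k < n)%N -> t k.+1 < r < t k /\ root P r.
  have [kn|] := boolP (k < n)%N; last by exists 0.
  have [|r] := @poly_ivtoo R P _ _ (ltW (dec k kn)).
    have := mulr_gt0 (sgn k (ltnW kn)) (sgn k.+1 kn).
    rewrite mulrACA -exprD addnS exprS -signr_odd oddD addbb mulr1 mulN1r.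
    by rewrite mulrC oppr_gt0.
  by rewrite inE /= => ? ?; exists r.
have [r Hr] := choice H.
have rlt k l : (k < l < n)%N -> r l < r k.
  move=> /andP[kl ln]; have kn := ltn_trans kl ln.
  have [/andP[_ h1] _] := Hr l ln; have [/andP[h2 _] _] := Hr k kn.
  by rewrite (lt_trans h1) // (le_lt_trans _ h2) // (alternates_le alt) // kl ltnW.
have ur : uniq [seq r k | k <- iota 0 n].
  rewrite map_inj_in_uniq ?iota_uniq // => k l.
  rewrite !mem_iota !add0n /= => kn ln kl.
  case: (ltngtP k l) => // [h|h].
    by have := rlt k l; rewrite h ln => /(_ isT); rewrite kl ltxx.
  by have := rlt l k; rewrite h kn => /(_ isT); rewrite kl ltxx.
rewrite (@all_roots_prod_XsubC _ P [seq r k | k <- iota 0 n]).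
- by apply: split_hyperbolic; rewrite lead_coef_eq0 -size_poly_eq0 sP.
- by rewrite size_map size_iota.
- apply/allP => x /mapP[k]; rewrite mem_iota add0n => /= kn ->.
  by have [] := Hr k kn.
- by rewrite uniq_rootsE.
Qed.

(** The points interlace the roots: one in each gap, one below all of them, and
    t_0 between the largest root and [b]. *)
Lemma split_alternates s b : uniq s -> (forall r, r \in s -> r < b) ->
  exists2 t, alternates (size s) (split_poly s) t & t 0%N < b.
Proof.
move=> us sb.
suff main u : sorted >%R (b :: u) ->
    exists2 t, alternates (size u) (split_poly u) t & t 0%N < b.
  have pe : perm_eq s (rev (sort <=%R s)).
    by rewrite perm_sym perm_rev perm_sort.
  have -> : split_poly s = split_poly (rev (sort <=%R s)).
    by rewrite /split_poly; apply: perm_big.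
  rewrite (perm_size pe); apply: main => /=; rewrite path_sortedE; last first.
    by move=> ? ? ? /= h1 h2; apply: lt_trans h2 h1.
  apply/andP; split.
    by apply/allP => x; rewrite mem_rev mem_sort => /sb.
  by rewrite (rev_sorted >%R) sort_lt_sorted.
elim: u b {sb} => [|r u IH] b /=.
  move=> _; exists (fun=> b - 1); last by rewrite gtrBl.
  split=> // k; rewrite leqn0 => /eqP ->.
  by rewrite /split_poly big_nil expr0 mul1r hornerC.
move=> /andP[rb pu]; have [t alt t0] := IH r pu.
have [dec sgn] := alt.
exists (fun k => if k is k'.+1 then t k' else (b + r) / 2); last by lra.
split=> [[|k] kn|[|k] kn].
- by lra.
- exact: dec.
- rewrite expr0 mul1r split_poly_cons hornerM hornerXsubC.
  rewrite mulr_gt0 //; first by lra.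
  rewrite /split_poly horner_prod big_seq prodr_gt0 // => x xu.
  rewrite hornerXsubC; move: pu; rewrite path_sortedE; last first.
    by move=> ? ? ? /= h1 h2; apply: lt_trans h2 h1.
  by case/andP => /allP/(_ _ xu) /= xr _; lra.
- rewrite split_poly_cons hornerM hornerXsubC exprS mulN1r.
  have tr : 0 < r - t k by rewrite subr_gt0 (le_lt_trans _ t0) // (alternates_le alt).
  have := mulr_gt0 tr (sgn k kn); congr (0 < _); ring.
Qed.

Lemma exists_lower_bound n (f : nat -> R) :
  (forall k, (k <= n)%N -> 0 < f k) ->
  exists2 e, 0 < e & forall k, (k <= n)%N -> e < f k.
Proof.
elim: n => [|n IH] f0.
  exists (f 0%N / 2); first by rewrite divr_gt0 // f0.
  by move=> k; rewrite leqn0 => /eqP ->; have := f0 0%N (leqnn _); lra.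
have [k kn|e e0 He] := IH; first by rewrite f0 // leqW.
have fn := f0 n.+1 (leqnn _).
exists (Num.min e (f n.+1 / 2)).
  by rewrite lt_min e0 divr_gt0.
move=> k; rewrite leq_eqVlt => /orP[/eqP ->|kn].
  by rewrite gt_min; apply/orP; right; lra.
by rewrite gt_min He.
Qed.

(** At negative alternation points of Q the polynomial X Q alternates with the
    opposite signs; adding a small e > 0 preserves these signs and creates a
    positive value close to 0. *)
Lemma alternates_extend n Q t : alternates n Q t -> t 0%N < 0 ->
  exists2 e, 0 < e & exists2 t', alternates n.+1 (Q * 'X + e%:P) t' & t' 0%N < 0.
Proof.
move=> alt t0; have [dec sgn] := alt.
have tneg k : (k <= n)%N -> t k < 0.
  by move=> kn; rewrite (le_lt_trans _ t0) // (alternates_le alt).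
have [k kn|e e0 He] := @exists_lower_bound n (fun k => - t k * ((-1) ^+ k * Q.[t k])).
  by rewrite mulr_gt0 ?sgn // oppr_gt0 tneg.
exists e => //.
have [d d0 Hd] := poly_cont 0 (Q * 'X + e%:P) e0.
pose x := Num.max (- d / 2) (t 0%N / 2).
have x0 : x < 0 by rewrite gt_max; apply/andP; split; lra.
have xt : t 0%N < x by rewrite lt_max; apply/orP; right; lra.
have Gx : 0 < (Q * 'X + e%:P).[x].
  have /Hd : `|x - 0| < d.
    rewrite subr0 ltr0_norm // ltrNl lt_max; apply/orP; left; lra.
  rewrite ltr_norml => /andP[h _]; move: h.
  rewrite [X in _ - X]hornerD hornerM hornerX hornerC mulr0 add0r.
  by move=> h; lra.
exists (fun k => if k is k'.+1 then t k' else x) => //.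
split=> [[|k] kn|[|k] kn] //.
- exact: dec.
- by rewrite expr0 mul1r.
- rewrite hornerD hornerM hornerX hornerC exprS mulN1r mulrDr.
  have h := He k kn.
  have : `|- (-1) ^+ k * e| <= e.
    by rewrite normrM normrN normr_sign mul1r ger0_norm // ltW.
  rewrite ler_norml => /andP[h' _].
  have -> : - (-1) ^+ k * (Q.[t k] * t k) = - t k * ((-1) ^+ k * Q.[t k]) by ring.
  lra.
Qed.

End Alternation.

(** * Hutchinson's sufficient condition *)

Section Hutchinson.
Variable R : realType.
Implicit Types (p b : nat -> R).

Lemma alternating_sum_bounds m b :
  (forall d, (d < m)%N -> 0 < b d) ->
  (forall d, (d.+1 < m)%N -> b d.+1 < b d) ->
  [/\ 0 <= \sum_(d < m) (-1) ^+ d * b d,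
      (0 < m)%N -> 0 < \sum_(d < m) (-1) ^+ d * b d <= b 0%N &
      (1 < m)%N -> \sum_(d < m) (-1) ^+ d * b d < b 0%N].
Proof.
elim: m b => [|m IH] b b0 dec; first by rewrite big_ord0.
have [h1 h2 h3] := IH (b \o S) (fun d => b0 d.+1) (fun d => dec d.+1).
rewrite big_ord_recl expr0 mul1r.
have -> : \sum_(i < m) (-1) ^+ lift ord0 i * b (lift ord0 i) =
    - \sum_(d < m) (-1) ^+ d * (b \o S) d.
  rewrite -sumrN; apply: eq_bigr => i _.
  by rewrite lift0 exprS mulN1r mulNr.
case: m {IH} b0 dec h1 h2 h3 => [|m] b0 dec h1 h2 h3.
  rewrite big_ord0 subr0; have h := b0 0%N isT.
  by split=> [|_|//]; [exact: ltW | rewrite h lexx].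
have /andP[h4 h5] := h2 isT; have h6 := dec 0%N isT; rewrite /= in h4 h5 h6 *.
by split=> [|_|_]; lra.
Qed.

(** A term which is at least twice each of its neighbours, away from which the
    terms decrease, determines the sign of the alternating sum. For three terms
    with the middle one dominant the sum may vanish, whence the exclusion. *)
Lemma dominant_alternating_sum n k b : (k <= n)%N -> ~~ ((k == 1) && (n == 2))%N ->
  (forall d, (d <= n)%N -> 0 < b d) ->
  (forall d, (d < k)%N -> b d < b d.+1) ->
  (forall d, (k < d < n)%N -> b d.+1 < b d) ->
  (forall d, (d.+1 = k)%N -> b d <= b k / 2) ->
  ((k < n)%N -> b k.+1 <= b k / 2) ->
  0 < (-1) ^+ k * \sum_(d < n.+1) (-1) ^+ d * b d.
Proof.
move=> kn nk2 b0 inc dec hl hu.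
have E : (-1) ^+ k * \sum_(d < n.+1) (-1) ^+ d * b d =
    b k - \sum_(d < k) (-1) ^+ d * b (k.-1 - d)%N
        - \sum_(d < n - k) (-1) ^+ d * b (k.+1 + d)%N.
  rewrite -(big_mkord xpredT (fun d => (-1) ^+ d * b d)).
  rewrite (big_cat_nat (n := k)) ?ltnS //= ?leqW // [\sum_(k <= i < n.+1) _]big_ltn ?ltnS //.
  have hL : (-1) ^+ k * \sum_(0 <= d < k) (-1) ^+ d * b d =
      - \sum_(d < k) (-1) ^+ d * b (k.-1 - d)%N.
    rewrite big_mkord (reindex_inj rev_ord_inj) mulr_sumr -sumrN.
    apply: eq_bigr => -[d dk] _ /=.
    have -> : (k - d.+1 = k.-1 - d)%N by lia.
    rewrite mulrA -exprD -mulNr; congr (_ * _).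
    rewrite -[RHS]mulN1r -exprS -[LHS]signr_odd -[RHS]signr_odd.
    by congr (_ ^+ nat_of_bool _); lia.
  have hU : (-1) ^+ k * \sum_(k.+1 <= d < n.+1) (-1) ^+ d * b d =
      - \sum_(d < n - k) (-1) ^+ d * b (k.+1 + d)%N.
    rewrite -{1}[k.+1]add0n big_addn subSS big_mkord mulr_sumr -sumrN.
    apply: eq_bigr => -[d dk] _ /=; rewrite [(d + _)%N]addnC mulrA -exprD -mulNr.
    congr (_ * _); rewrite -[RHS]mulN1r -exprS -[LHS]signr_odd -[RHS]signr_odd.
    by congr (_ ^+ nat_of_bool _); lia.
  rewrite !mulrDr hL hU mulrA -expr2 sqrr_sign mul1r; ring.
rewrite E.
have [|| l1 l2 l3] := @alternating_sum_bounds k (fun d => b (k.-1 - d)%N).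
- by move=> d dk; apply: b0; lia.
- move=> d dk; have -> : (k.-1 - d = (k.-1 - d.+1).+1)%N by lia.
  by apply: inc; lia.
have [|| u1 u2 u3] := @alternating_sum_bounds (n - k) (fun d => b (k.+1 + d)%N).
- by move=> d dk; apply: b0; lia.
- by move=> d dk; rewrite addnS; apply: dec; lia.
rewrite subn0 in l2 l3; rewrite addn0 in u2 u3.
have bk := b0 k kn.
set L := \sum_(d < k) _ in l1 l2 l3 *; set U := \sum_(d < n - k) _ in u1 u2 u3 *.
have hL : L <= b k / 2.
  case: (posnP k) => [k0|k0]; first by rewrite /L k0 big_ord0 divr_ge0 // -k0 ltW.
  by have /andP[_ h] := l2 k0; apply: le_trans h (hl _ _); rewrite prednK.
have hU : U <= b k / 2.
  case: (posnP (n - k)) => [k0|k0]; first by rewrite /U k0 big_ord0 divr_ge0 // ltW.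
  by have /andP[_ h] := u2 k0; apply: le_trans h (hu _); rewrite -subn_gt0.
have [k1|k1|k1] := ltngtP k 1.
- have k0 : k = 0%N by move: k1; clear; lia.
  rewrite k0 in bk hU *; rewrite /L k0 big_ord0; lra.
- have hL' : L < b k / 2.
    by apply: lt_le_trans (l3 k1) (hl _ _); rewrite prednK // ltnW.
  lra.
have [u|u|u] := ltngtP (n - k) 1.
- have u0 : (n - k = 0)%N by move: u; clear; lia.
  by move: hU bk; rewrite /U u0 big_ord0; lra.
- have hU' : U < b k / 2.
    by apply: lt_le_trans (u3 u) (hu _); rewrite -subn_gt0 ltnW.
  lra.
by exfalso; move: nk2 u; rewrite k1 /=; clear; lia.
Qed.

Lemma hyperbolic_quadratic p : (forall d, (d <= 2)%N -> 0 < p d) ->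
  4 * (p 0%N * p 2%N) <= p 1%N ^+ 2 -> hyperbolic (\poly_(d < 3) p d).
Proof.
move=> p0 hp [x y].
rewrite /root (@horner_coef_wide _ 3); last first.
  by rewrite size_map_poly size_poly.
rewrite !big_ord_recl big_ord0 !coef_map !coef_poly /= eq_complex /=.
have := p0 2%N isT; have := p0 1%N isT; have := p0 0%N isT.
rewrite /bump /= ?add1n ?addn0.
move: hp; move: (p 0%N) (p 1%N) (p 2%N) => c b a hp c0 b0 a0.
rewrite !(mul0r, mulr0, mul1r, mulr1, add0r, addr0, subr0).
move=> /andP[/eqP h1 /eqP h2]; apply/eqP/negP => /negP y0.
have h3 : 2 * a * x = - b.
  apply/eqP; rewrite -addr_eq0; apply/eqP; apply: (mulIf y0).
  by rewrite mul0r -h2; ring.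
have : 0 < 4 * a ^+ 2 * y ^+ 2.
  apply: mulr_gt0; last by rewrite exprn_even_gt0.
  by apply: mulr_gt0 => //; apply: exprn_gt0.
suff -> : 4 * a ^+ 2 * y ^+ 2 = 4 * (c * a) - b ^+ 2 by lra.
have -> : b = - (2 * a * x) by rewrite h3 opprK.
have -> : c = - (b * x + a * (x * x - y * y)) by apply/eqP; rewrite -addr_eq0 h1.
have -> : b = - (2 * a * x) by rewrite h3 opprK.
ring.
Qed.

(** The theorem of Hutchinson and Kurtz, with nonstrict inequalities. *)
Lemma hyperbolic_hutchinson n p : (forall d, (d <= n)%N -> 0 < p d) ->
  (forall d, (d.+2 <= n)%N -> 4 * (p d * p d.+2) <= p d.+1 ^+ 2) ->
  hyperbolic (\poly_(d < n.+1) p d).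
Proof.
move=> p0 hp.
have [n2|n2] := eqVneq n 2.
  by rewrite n2 in p0 hp *; apply: hyperbolic_quadratic => //; apply: hp.
have sP : size (\poly_(d < n.+1) p d) = n.+1.
  by rewrite size_poly_eq // gt_eqF // p0.
pose u k := p k.-1 / p k.
have u0 k : (0 < k <= n)%N -> 0 < u k.
  by move=> /andP[k0 kn]; rewrite divr_gt0 ?p0 // (leq_trans (leq_pred _)).
have uS k : (0 < k < n)%N -> 4 * u k <= u k.+1.
  case: k => [//|k] /= kn; rewrite /u /= mulrA ler_pdivrMr ?p0 1?ltnW //.
  rewrite mulrAC ler_pdivlMr ?p0 // -mulrA -expr2; exact: hp.
have ule k l : (0 < k <= l)%N -> (l <= n)%N -> u k <= u l.
  move=> /andP[k0]; elim: l => [|l IH] kl ln.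
    by move: k0; rewrite leqn0 in kl; rewrite (eqP kl).
  move: kl; rewrite leq_eqVlt => /orP[/eqP -> //|kl].
  have := IH kl (ltnW ln); have := uS l; rewrite (leq_trans k0 kl) ln => /(_ isT).
  have := u0 l; rewrite (leq_trans k0 kl) ltnW // => /(_ isT); lra.
have ult k l : (0 < k < l)%N -> (l <= n)%N -> 4 * u k <= u l.
  move=> /andP[k0 kl] ln; apply: le_trans (uS k _) (ule _ _ _ _) => //.
  by rewrite k0 (leq_trans kl ln).
(* at - t k the neighbours of the k-th term are at most half of it *)
pose t k : R := if k == 0%N then 0 else 2 * u k.
apply: (@alternates_hyperbolic _ n _ (fun k => - t k)) => //; split.
  move=> [|k] kn; rewrite ltrN2 /t /=.
    by rewrite mulr_gt0 // u0.
  have := uS k.+1 kn; have := u0 k.+1; rewrite (ltnW kn) => /(_ isT); lra.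
move=> k kn; rewrite horner_poly.
have [k0|k0] := posnP k.
  rewrite k0 /t /= expr0 mul1r big_ord_recl expr0 mulr1 big1 ?addr0 ?p0 //.
  by move=> i _; rewrite oppr0 lift0 expr0n mulr0.
have tE : t k = 2 * u k by rewrite /t; case: (k) k0.
have uk0 : 0 < u k by rewrite u0 ?k0.
have t0 : 0 < t k by rewrite tE mulr_gt0.
have -> : \sum_(i < n.+1) p i * (- t k) ^+ i =
   \sum_(d < n.+1) (-1) ^+ d * (p d * t k ^+ d).
  by apply: eq_bigr => i _; rewrite (exprNn (t k)) mulrCA.
have step d : (d < n)%N -> p d = u d.+1 * p d.+1.
  by move=> dn; rewrite /u /= divfK // gt_eqF ?p0.
have tdp d : (d <= n)%N -> 0 < p d * t k ^+ d.
  by move=> dn; rewrite mulr_gt0 ?p0 ?exprn_gt0.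
have sE d : (d < n)%N -> p d * t k ^+ d * t k = u d.+1 * (p d.+1 * t k ^+ d.+1).
  by move=> dn; rewrite (step d dn) exprSr !mulrA.
apply: (@dominant_alternating_sum n k (fun d => p d * t k ^+ d)) => //.
- by rewrite (negPf n2) andbF.
- move=> d dk; have dn := leq_trans dk kn.
  rewrite -(ltr_pM2r t0) sE // [ltRHS]mulrC ltr_pM2r ?tdp // tE.
  have := ule d.+1 k; rewrite dk kn => /(_ isT isT); lra.
- move=> d /andP[kd dn].
  have := ult k d.+1; rewrite k0 (leq_trans kd) // dn => /(_ isT isT) h.
  rewrite -(ltr_pM2r t0) (sE d dn) mulrC ltr_pM2r ?tdp // tE; lra.
- move=> d dk; have dn : (d < n)%N by rewrite dk.
  rewrite -(ler_pM2r t0) (sE d dn) dk tE.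
  by rewrite le_eqVlt; apply/orP; left; apply/eqP; field.
- move=> kn'; have := ult k k.+1; rewrite k0 ltnSn kn' => /(_ isT isT) h.
  have h1 := sE k kn'; have h2 := tdp k.+1 kn'.
  rewrite tE in h1 h2 *; nra.
Qed.
End Hutchinson.

(** * Newton's inequalities, signs of coefficients and a lower bound off the real axis *)

Section Newton.
Variable R : realType.
Implicit Types (P Q : {poly R}) (s : seq R) (z : R[i]) (p c : nat -> R) (x r : R).
Local Notation toC := (real_complex R).
Local Notation Im := (@complex.Im R).
Local Notation normc := (@Normc.normc R).

Lemma hyperbolic_derivn P n j : (j < n)%N -> (size P <= n.+1)%N ->
  (forall d, (d <= n)%N -> 0 < P`_d) -> hyperbolic P ->
  hyperbolic P^`(j) /\ (size P^`(j) <= n.+1 - j)%N.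
Proof.
move=> jn sP P0 hP; elim: j jn => [|j IH] jn; first by rewrite derivn0 subn0.
have [hj sj] := IH (ltnW jn).
have s1 : (1 < size P^`(j))%N.
  rewrite ltnNge; apply/negP => h; have := nth_default 0 h.
  rewrite coef_derivn; apply/eqP; rewrite mulrn_eq0 negb_or -lt0n ffact_gt0.
  by rewrite leq_addr gt_eqF // P0 // addn1 ltnW.
rewrite derivnS; split; first exact: hyperbolic_deriv.
have := @lt_size_deriv _ P^`(j); rewrite -size_poly_eq0 => h.
have := h _; move: s1 sj; case: size => // m _ sj /(_ isT).
by move: jn sj; clear; lia.
Qed.

(** Cauchy-Schwarz applied at 0 to the logarithmic derivative of the j-th
    derivative, which has degree n - j. *)
Lemma newton_ineq P n j : (j.+2 <= n)%N -> (size P <= n.+1)%N ->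
  (forall d, (d <= n)%N -> 0 < P`_d) -> hyperbolic P ->
  ((n - j) * j.+2)%:R * (P`_j * P`_j.+2) <=
  ((n - j.+1) * j.+1)%:R * P`_j.+1 ^+ 2.
Proof.
move=> jn sP P0 hP.
have [hj sj] := hyperbolic_derivn (ltnW jn) sP P0 hP.
have v i : P^`(i).[0] = P`_i * i`!%:R.
  by rewrite horner_coef0 coef_derivn addn0 ffactnn mulr_natr.
have pj : 0 < P`_j by apply: P0; rewrite ltnW // ltnW.
have pj1 : 0 < P`_j.+1 by apply: P0; rewrite ltnW.
have pj2 : 0 < P`_j.+2 by apply: P0.
have fj : 0 < j`!%:R :> R by rewrite ltr0n fact_gt0.
have [|S1 [S2 [d1 d2 S12 S20]]] := @hyperbolic_log_deriv _ _ 0 hj.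
  by rewrite v mulf_neq0 // gt_eqF.
rewrite -!derivnS in d1 d2; rewrite !v in d1 d2.
have s1 : (1 < size P^`(j))%N.
  rewrite ltnNge; apply/negP => h; have := nth_default 0 h.
  rewrite coef_derivn; apply/eqP; rewrite mulrn_eq0 negb_or -lt0n ffact_gt0.
  by rewrite leq_addr gt_eqF // addn1.
have S1le : S1 ^+ 2 <= (n - j)%:R * S2.
  apply: le_trans S12 _; rewrite ler_pM2r ?S20 // ler_nat.
  by move: sj jn; clear; lia.
rewrite !factS !natrM in d1 d2.
have e1 : P`_j.+1 * j.+1%:R = P`_j * S1.
  by apply: (mulIf (lt0r_neq0 fj)); rewrite -mulrA d1 mulrAC.
have e2 : P`_j.+2 * (j.+2%:R * j.+1%:R) = P`_j * (S1 ^+ 2 - S2).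
  by apply: (mulIf (lt0r_neq0 fj)); rewrite -!mulrA d2 mulrAC -mulrA.
have j1 : 0 < j.+1%:R :> R by rewrite ltr0n.
rewrite !natrM; have -> : (n - j.+1)%:R = (n - j)%:R - 1 :> R.
  by rewrite subnS -subn1 natrB // subn_gt0 ltnW.
have key : (n - j)%:R * (S1 ^+ 2 - S2) <= ((n - j)%:R - 1) * S1 ^+ 2 by lra.
rewrite -(ler_pM2r j1) -(ler_pM2r j1).
have -> : (n - j)%:R * j.+2%:R * (P`_j * P`_j.+2) * j.+1%:R * j.+1%:R =
  j.+1%:R * P`_j * ((n - j)%:R * (P`_j.+2 * (j.+2%:R * j.+1%:R))) by ring.
have -> : ((n - j)%:R - 1) * j.+1%:R * P`_j.+1 ^+ 2 * j.+1%:R * j.+1%:R =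
  j.+1%:R * ((n - j)%:R - 1) * (P`_j.+1 * j.+1%:R) ^+ 2 by ring.
rewrite e1 e2.
have -> : j.+1%:R * P`_j * ((n - j)%:R * (P`_j * (S1 ^+ 2 - S2))) =
  j.+1%:R * P`_j ^+ 2 * ((n - j)%:R * (S1 ^+ 2 - S2)) by ring.
have -> : j.+1%:R * ((n - j)%:R - 1) * (P`_j * S1) ^+ 2 =
  j.+1%:R * P`_j ^+ 2 * (((n - j)%:R - 1) * S1 ^+ 2) by ring.
by rewrite ler_wpM2l // mulr_ge0 // ?sqr_ge0 // ltW.
Qed.

Lemma split_poly_coef_gt0 s d : (forall r, r \in s -> r < 0) ->
  (d <= size s)%N -> 0 < (split_poly s)`_d.
Proof.
elim: s d => [|r s IH] d s0 ds.
  by move: ds; rewrite leqn0 => /eqP ->; rewrite /split_poly big_nil coefC.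
have r0 : r < 0 by rewrite s0 ?mem_head.
have {}IH e : (e <= size s)%N -> 0 < (split_poly s)`_e.
  by move=> es; apply: IH => // x xs; rewrite s0 // inE xs orbT.
have ge0 e : 0 <= (split_poly s)`_e.
  have [es|es] := leqP e (size s); first by rewrite ltW ?IH.
  by rewrite nth_default // size_prod_XsubC.
rewrite split_poly_cons mulrBl coefB coefXM coefCM.
case: d ds => [|d] /= ds; first by rewrite sub0r -mulNr mulr_gt0 ?oppr_gt0 ?IH.
by have := IH d ds; have := ge0 d.+1; nra.
Qed.

Lemma coef_gt0_root_lt0 P n x : size P = n.+1 ->
  (forall d, (d <= n)%N -> 0 < P`_d) -> root P x -> x < 0.
Proof.
move=> sP P0 /eqP rx; rewrite ltNge; apply/negP => x0.
have : 0 < P.[x]; last by rewrite rx ltxx.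
rewrite horner_coef sP big_ord_recl expr0 mulr1 ltr_pwDl ?P0 //.
by apply: sumr_ge0 => i _; rewrite mulr_ge0 ?exprn_ge0 // ltW // P0 // lift0.
Qed.

Lemma root_lt0_coef_gt0 P n : size P = n.+1 -> 0 < lead_coef P ->
  hyperbolic P -> (forall x, root P x -> x < 0) ->
  forall d, (d <= n)%N -> 0 < P`_d.
Proof.
move=> sP l0 hP P0 d dn; have [s E] := hyperbolic_split (hyperbolic_neq0 hP) hP.
have ln0 : lead_coef P != 0 by rewrite gt_eqF.
rewrite E coefZ mulr_gt0 // split_poly_coef_gt0 //.
  by move=> r rs; apply: P0; rewrite E rootZ // root_prod_XsubC.
by move: sP; rewrite E size_scale // size_prod_XsubC => -[->].
Qed.

Lemma normc_ge_norm_Im z : `|Im z| <= normc z.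
Proof.
case: z => x y /=; rewrite -sqrtr_sqr; apply: ler_wsqrtr.
by rewrite lerDr sqr_ge0.
Qed.

Lemma normc_ge_norm_Re z : `|complex.Re z| <= normc z.
Proof.
case: z => x y /=; rewrite -sqrtr_sqr; apply: ler_wsqrtr.
by rewrite lerDl sqr_ge0.
Qed.

Lemma normc_toC x : normc (toC x) = `|x|.
Proof. by rewrite /= expr0n addr0 sqrtr_sqr. Qed.

Lemma normc_prod (I : Type) (t : seq I) (f : I -> R[i]) :
  normc (\prod_(i <- t) f i) = \prod_(i <- t) normc (f i).
Proof.
elim: t => [|i t IH]; first by rewrite !big_nil Normc.normc1.
by rewrite !big_cons Normc.normcM IH.
Qed.

Lemma normc_sub_ge z r : r < 0 -> Im z != 0 ->
  `|Im z| / (3 * normc z) * (normc z - r) <= normc (z - toC r).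
Proof.
move=> r0 z0; have y0 : 0 < `|Im z| by rewrite normr_gt0.
have hy := normc_ge_norm_Im z; have hx := normc_ge_norm_Re z.
have n0 : 0 < normc z := lt_le_trans y0 hy.
have h1 := normc_ge_norm_Im (z - toC r); have h2 := normc_ge_norm_Re (z - toC r).
have e1 : Im (z - toC r) = Im z by case: (z) => ? ? /=; rewrite subr0.
have e2 : complex.Re (z - toC r) = complex.Re z - r by case: (z) => ? ? /=.
rewrite e1 in h1; rewrite e2 in h2.
move: (normc (z - toC r)) h1 h2 => N h1 h2.
rewrite mulrAC ler_pdivrMr ?mulr_gt0 //.
move: hx h2; rewrite !ler_norml => /andP[hx1 hx2] /andP[h3 h4].
move: (`|Im z|) y0 hy h1 => y y0 hy h1.
(* for a root of modulus at most 2 |z| the imaginary part suffices; for a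
   larger one the real part does *)
have [c|c] := leP (- r) (2 * normc z); nra.
Qed.

(** A hyperbolic polynomial with negative roots cannot be much smaller at a
    nonreal point than at the positive point of the same modulus. *)
Lemma hyperbolic_normc_ge P z : hyperbolic P -> 0 < lead_coef P ->
  (forall x, root P x -> x < 0) -> Im z != 0 ->
  (`|Im z| / (3 * normc z)) ^+ (size P).-1 * P.[normc z] <=
  normc (map_poly toC P).[z].
Proof.
move=> hP l0 P0 z0; have [s E] := hyperbolic_split (hyperbolic_neq0 hP) hP.
have ln0 : lead_coef P != 0 by rewrite gt_eqF.
have sneg r : r \in s -> r < 0.
  by move=> rs; apply: P0; rewrite E rootZ // root_prod_XsubC.
rewrite E size_scale // size_prod_XsubC /= map_polyZ map_split_poly.
rewrite !hornerZ Normc.normcM normc_toC (gtr0_norm l0) mulrCA ler_pM2l //.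
have n0 : 0 < normc z.
  by apply: lt_le_trans (normc_ge_norm_Im z); rewrite normr_gt0.
have k0 : 0 <= `|Im z| / (3 * normc z) by rewrite divr_ge0 // mulr_ge0 // ltW.
rewrite /split_poly !horner_prod normc_prod big_map.
elim: s {E} sneg => [|r s IH] sneg; first by rewrite !big_nil mulr1.
rewrite !big_cons /= exprS mulrACA ler_pM //.
- rewrite mulr_ge0 // hornerXsubC subr_ge0 ltW //.
  by rewrite (lt_trans _ n0) // sneg ?mem_head.
- rewrite mulr_ge0 ?exprn_ge0 // ltW //.
  rewrite big_seq prodr_gt0 // => x xs; rewrite hornerXsubC subr_gt0.
  by rewrite (lt_trans _ n0) // sneg // inE xs orbT.
- by rewrite !hornerXsubC normc_sub_ge // sneg ?mem_head.
- by apply: IH => x xs; rewrite sneg // inE xs orbT.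
Qed.

Lemma quadratic_nonreal_root (a b d : R) : 0 < a -> b ^+ 2 < 4 * (d * a) ->
  exists2 z, Im z != 0 & toC d + toC b * z + toC a * z ^+ 2 = 0.
Proof.
move=> a0 h; pose w := Num.sqrt (4 * (d * a) - b ^+ 2).
have w2 : w ^+ 2 = 4 * (d * a) - b ^+ 2 by rewrite sqr_sqrtr // subr_ge0 ltW.
have w0 : 0 < w by rewrite sqrtr_gt0 subr_gt0.
have an : a != 0 by rewrite gt_eqF.
exists (Complex (- b / (2 * a)) (w / (2 * a))) => /=.
  by rewrite gt_eqF // divr_gt0 ?mulr_gt0.
rewrite expr2; apply/eqP; rewrite eq_complex /=.
rewrite !(mul0r, addr0, subr0); apply/andP; split; apply/eqP; last by field.
have -> : d = (w ^+ 2 + b ^+ 2) / (4 * a) by rewrite w2; field.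
by field.
Qed.
End Newton.

(** * Damping all terms but three consecutive ones *)

Section Middle.
Variable R : realType.
Implicit Types (P Q : {poly R}) (z : R[i]) (c : nat -> R) (x r : R).
Local Notation toC := (real_complex R).
Local Notation Im := (@complex.Im R).
Local Notation normc := (@Normc.normc R).

Lemma normc_sum_le (I : Type) (t : seq I) (f : I -> R[i]) :
  normc (\sum_(i <- t) f i) <= \sum_(i <- t) normc (f i).
Proof.
elim: t => [|i t IH]; first by rewrite !big_nil Normc.normc0.
rewrite !big_cons; apply: le_trans (le_normcD _ _) _.
by rewrite lerD2l.
Qed.

Lemma normcX z k : normc (z ^+ k) = normc z ^+ k.
Proof.
elim: k => [|k IH]; first by rewrite !expr0 Normc.normc1.
by rewrite !exprS Normc.normcM IH.
Qed.

(** The exponent (e - d) + (d - (e + 2)), with truncated subtractions, is the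
    distance from d to the block {e, e + 1, e + 2}. The terms of that block
    cancel at [z], and each of the others carries at least one factor [eta]. *)
Lemma damped_horner_le n e c z eta : (e.+2 <= n)%N ->
  (forall d, (d <= n)%N -> 0 < c d) -> 0 < eta < 1 ->
  toC (c e) + toC (c e.+1) * z + toC (c e.+2) * z ^+ 2 = 0 ->
  normc (map_poly toC (\poly_(d < n.+1) (c d * eta ^+ (e - d + (d - e.+2))))).[z]
    <= eta * \sum_(0 <= d < n.+1) c d * normc z ^+ d.
Proof.
move=> en c0 /andP[eta0 eta1] zE; set rho := normc z.
have rho0 : 0 <= rho by rewrite /rho; case: (z) => ? ?; apply: sqrtr_ge0.
pose T d := toC (c d * eta ^+ (e - d + (d - e.+2))) * z ^+ d.
have -> : (map_poly toC (\poly_(d < n.+1)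
    (c d * eta ^+ (e - d + (d - e.+2))))).[z] = \sum_(0 <= d < n.+1) T d.
  rewrite (@horner_coef_wide _ n.+1); last by rewrite size_map_poly size_poly.
  rewrite big_mkord; apply: eq_bigr => -[d dn] _ /=.
  by rewrite coef_map coef_poly dn.
have e1 : (e <= n.+1)%N by move: en; clear; lia.
have e3 : (e.+3 <= n.+1)%N by move: en; clear; lia.
have split3 (V : zmodType) (f : nat -> V) : \sum_(0 <= d < n.+1) f d =
    \sum_(0 <= d < e) f d + (f e + f e.+1 + f e.+2) + \sum_(e.+3 <= d < n.+1) f d.
  rewrite (big_cat_nat (n := e)) //= -addrA; congr (_ + _).
  rewrite (big_cat_nat (n := e.+3)) //=; last by move: (leqnn e); clear; lia.
  congr (_ + _); rewrite big_ltn; last by clear; lia.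
  rewrite big_ltn; last by clear; lia.
  by rewrite big_ltn // big_geq // addr0 addrA.
have bd d : (d <= n)%N -> (d < e)%N || (e.+2 < d)%N ->
    normc (T d) <= eta * (c d * rho ^+ d).
  move=> dn dne; rewrite /T Normc.normcM normcX -/rho.
  rewrite (_ : normc _ = c d * eta ^+ (e - d + (d - e.+2))); last first.
    rewrite normc_toC gtr0_norm // mulr_gt0 ?c0 ?exprn_gt0 //.
  rewrite mulrA [eta * c d]mulrC ler_wpM2r ?exprn_ge0 // ler_pM2l ?c0 //.
  have : (0 < e - d + (d - e.+2))%N by move: dne; clear; lia.
  case: (_ + _)%N => // w _; rewrite exprS ler_piMr ?(ltW eta0) //.
  by rewrite exprn_ile1 ?ltW.
rewrite !split3.
have -> : T e + T e.+1 + T e.+2 = 0.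
  rewrite /T; have -> : (e - e + (e - e.+2) = 0)%N by clear; lia.
  have -> : (e - e.+1 + (e.+1 - e.+2) = 0)%N by clear; lia.
  have -> : (e - e.+2 + (e.+2 - e.+2) = 0)%N by clear; lia.
  rewrite expr0 !mulr1 !exprS.
  transitivity ((toC (c e) + toC (c e.+1) * z + toC (c e.+2) * z ^+ 2) * z ^+ e).
    by ring.
  by rewrite zE mul0r.
rewrite addr0 !mulrDr.
apply: le_trans (le_normcD _ _) _.
apply: lerD; last first.
  apply: le_trans (normc_sum_le _ _) _; rewrite mulr_sumr !big_nat.
  by apply: ler_sum => d /andP[d1 d2]; apply: bd; rewrite ?d1 ?orbT.
rewrite -[leLHS]addr0; apply: lerD.
  apply: le_trans (normc_sum_le _ _) _; rewrite mulr_sumr !big_nat.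
  apply: ler_sum => d /andP[_ d2]; apply: bd; rewrite ?d2 //.
  by rewrite -ltnS (leq_trans d2).
have ce d : (d <= e.+2)%N -> 0 <= eta * (c d * rho ^+ d).
  move=> h; rewrite mulr_ge0 ?(ltW eta0) // mulr_ge0 ?exprn_ge0 //.
  by rewrite ltW // c0 // (leq_trans h).
by rewrite !addr_ge0 // ce //; apply: ltnW.
Qed.

Lemma damped_not_hyperbolic n e c : (e.+2 <= n)%N ->
  (forall d, (d <= n)%N -> 0 < c d) ->
  c e.+1 ^+ 2 < 4 * (c e * c e.+2) ->
  exists2 eta, 0 < eta < 1 &
    ~ hyperbolic (\poly_(d < n.+1) (c d * eta ^+ (e - d + (d - e.+2)))).
Proof.
move=> en c0 disc; have [z z0 zE] := quadratic_nonreal_root (c0 _ en) disc.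
set rho := normc z.
have rho0 : 0 < rho by apply: lt_le_trans (normc_ge_norm_Im z); rewrite normr_gt0.
pose k := `|Im z| / (3 * rho).
have k0 : 0 < k by rewrite divr_gt0 ?normr_gt0 // mulr_gt0.
pose M := \sum_(0 <= d < n.+1) c d * rho ^+ d.
have cr d : (d <= n)%N -> 0 < c d * rho ^+ d.
  by move=> dn; rewrite mulr_gt0 ?c0 ?exprn_gt0.
have M0 : 0 < M.
  rewrite /M big_ltn // ltr_pwDl ?cr // big_nat sumr_ge0 // => d /andP[_ dn].
  by rewrite ltW // cr.
pose m := c e.+1 * rho ^+ e.+1.
have m0 : 0 < m by rewrite cr // ltnW.
(* the second bound gives eta M < k^n m *)
pose eta := Num.min (1 / 2) (k ^+ n * m / (2 * M)).
have kn0 : 0 < k ^+ n by apply: exprn_gt0.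
have km0 : 0 < k ^+ n * m / (2 * M).
  by apply: divr_gt0; apply: mulr_gt0.
have eta0 : 0 < eta by rewrite lt_min km0 andbT divr_gt0.
have eta1 : eta < 1 by rewrite gt_min; apply/orP; left; lra.
have etaM : eta * M < k ^+ n * m.
  apply: (@le_lt_trans _ _ (k ^+ n * m / (2 * M) * M)).
    by rewrite ler_pM2r // ge_min lexx orbT.
  have -> : k ^+ n * m / (2 * M) * M = k ^+ n * m / 2.
    by rewrite -mulrA invfM mulfVK // gt_eqF.
  have : 0 < k ^+ n * m by apply: mulr_gt0.
  lra.
exists eta; first by rewrite eta0.
set F := \poly_(d < _) _ => hF.
have a0 d : (d <= n)%N -> 0 < c d * eta ^+ (e - d + (d - e.+2)).
  by move=> dn; rewrite mulr_gt0 ?c0 ?exprn_gt0.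
have sF : size F = n.+1 by rewrite size_poly_eq // gt_eqF // a0.
have Fd d : (d <= n)%N -> 0 < F`_d by move=> dn; rewrite coef_poly ltnS dn a0.
have l0 : 0 < lead_coef F by rewrite lead_coefE sF Fd.
have h1 := hyperbolic_normc_ge hF l0 (fun x => @coef_gt0_root_lt0 R F n x sF Fd) z0.
have h2 := damped_horner_le en c0 (_ : 0 < eta < 1) zE.
rewrite eta0 eta1 in h2; have := le_trans h1 (h2 isT).
rewrite -/rho -/k -/M sF /= leNgt => /negP; apply.
apply: lt_le_trans etaM _; rewrite ler_pM2l ?exprn_gt0 //.
rewrite horner_poly -(big_mkord xpredT
  (fun d => c d * eta ^+ (e - d + (d - e.+2)) * rho ^+ d)).
have en' : (e.+1 < n.+1)%N by rewrite ltnS ltnW.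
rewrite (big_cat_nat (n := e.+1)) ?(ltnW en') //= [X in _ + X]big_ltn //.
have -> : (e - e.+1 + (e.+1 - e.+2) = 0)%N by clear; lia.
rewrite expr0 mulr1 -/m addrCA lerDl addr_ge0 //.
  rewrite big_nat sumr_ge0 // => d /andP[_ dn].
  by rewrite mulr_ge0 ?exprn_ge0 ?(ltW rho0) // ltW // a0 // (leq_trans (ltnW dn)) // ltnW.
rewrite big_nat sumr_ge0 // => d /andP[_ dn].
by rewrite mulr_ge0 ?exprn_ge0 ?(ltW rho0) // ltW // a0.
Qed.

End Middle.

(** * Sections of a polynomial *)

Section Sections.
Variable R : realType.
Implicit Types (P Q : {poly R}) (a b : nat -> R) (n i j k : nat) (x r : R).

(** The polynomial a_0 x^n + a_1 x^(n-1) + ... + a_n. For P in Pol n, the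
    section of length i of P is [sec (acoef n P) i] up to a power of x. *)
Definition sec a n : {poly R} := \poly_(d < n.+1) a (n - d)%N.

Lemma secS a n : sec a n.+1 = sec a n * 'X + (a n.+1)%:P.
Proof.
apply/polyP => -[|d]; rewrite coefD coefMX coefC !coef_poly /=.
  by rewrite add0r.
by rewrite addr0 subSS.
Qed.

Lemma coef_sec a n d : (d <= n)%N -> (sec a n)`_d = a (n - d)%N.
Proof. by move=> dn; rewrite coef_poly ltnS dn. Qed.

Lemma acoef_sec a n i : (i <= n)%N -> acoef n (sec a n) i = a i.
Proof. by move=> hi; rewrite /acoef coef_sec ?leq_subr // subKn. Qed.

Lemma sec_acoef n P : (size P <= n.+1)%N -> sec (acoef n P) n = P.
Proof.
move=> sP; apply/polyP => d; rewrite coef_poly /acoef.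
case: ltnP => h; first by rewrite subKn.
by rewrite nth_default // (leq_trans sP).
Qed.

Lemma eq_sec a b n : (forall i, (i <= n)%N -> a i = b i) -> sec a n = sec b n.
Proof.
move=> ab; apply/polyP => d; rewrite !coef_poly.
by case: ifP => // _; rewrite ab // leq_subr.
Qed.

Lemma size_sec a n : a 0%N != 0 -> size (sec a n) = n.+1.
Proof. by move=> a0; rewrite size_poly_eq // subnn. Qed.

Lemma Pol_sec a n : a 0%N = 1 -> Pol n (sec a n).
Proof.
move=> a0; have s : size (sec a n) = n.+1 by rewrite size_sec // a0 oner_eq0.
split=> //; apply/monicP; rewrite lead_coefE s /= coef_sec //.
by rewrite subnn.
Qed.

Lemma acoef0 n P : Pol n P -> acoef n P 0 = 1.
Proof. by move=> [/monicP]; rewrite lead_coefE => <- ->; rewrite /acoef subn0. Qed.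

Lemma acoef_coef n P d : (d <= n)%N -> P`_d = acoef n P (n - d).
Proof. by move=> dn; rewrite /acoef subKn. Qed.

Lemma segment_poly j k P : (j <= k)%N ->
  segment j k P = 'X^j * \poly_(d < (k - j).+1) P`_(j + d).
Proof.
move=> jk; rewrite /segment -{1}[j]add0n big_addn subSn // big_mkord.
rewrite poly_def mulr_sumr; apply: eq_bigr => i _.
by rewrite -scalerAr -exprD addnC.
Qed.

Lemma segment_sec n i P : (i <= n)%N ->
  segment (n - i) n P = 'X^(n - i) * sec (acoef n P) i.
Proof.
move=> hi; rewrite segment_poly ?leq_subr // subKn //; congr (_ * _).
apply/polyP => d; rewrite !coef_poly; case: ltnP => // dn; rewrite /acoef.
by congr (P`_ _); move: dn hi; clear; lia.
Qed.

(** The condition defining [Delta R k], in terms of the coefficient sequence;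
    the values of [a] beyond [k] are irrelevant. *)
Definition sections_hyperbolic k a : Prop :=
  [/\ a 0%N = 1, (forall i, (i <= k)%N -> 0 < a i) &
    (forall i, (i <= k)%N -> hyperbolic (sec a i))].

Lemma Delta_acoef k P : Delta R k P -> sections_hyperbolic k (acoef k P).
Proof.
move=> [PP Ppos Ph]; have a0 := acoef0 PP; split=> // -[|i] hi.
- by rewrite a0.
- by apply: Ppos; rewrite hi.
- rewrite (_ : sec _ _ = 1); first by apply: hyperbolicC; rewrite oner_eq0.
  apply/polyP => d; rewrite coef_poly coefC; case: d => [|d] //=.
- by apply/(hyperbolicXnM (k - i.+1)); rewrite -segment_sec //; apply: Ph.
Qed.

Lemma Delta_sec k a : sections_hyperbolic k a -> Delta R k (sec a k).
Proof.
move=> [a0 apos ah]; split; first exact: Pol_sec.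
- by move=> i /andP[_ ik]; rewrite acoef_sec // apos.
- move=> i /andP[i0 ik]; rewrite segment_sec //; apply/hyperbolicXnM.
  rewrite (@eq_sec _ a); first exact: ah.
  by move=> l li; rewrite acoef_sec // (leq_trans li ik).
Qed.

(** With F the product of X and the section of length k, both F and
    F + a_(k+1) are hyperbolic, hence F + x a_(k+1) is hyperbolic with simple
    roots. *)
Lemma sections_hyperbolic_shrink k a x : sections_hyperbolic k.+1 a -> 0 < x < 1 ->
  exists b, [/\ sections_hyperbolic k.+1 b, forall i, (i <= k)%N -> b i = a i,
    b k.+1 = x * a k.+1 &
    exists2 t, alternates k.+1 (sec b k.+1) t & t 0%N < 0].
Proof.
move=> [a0 apos ah] /andP[x0 x1].
pose b i := if (i <= k)%N then a i else x * a i.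
have ba i : (i <= k)%N -> b i = a i by rewrite /b => ->.
have bk : b k.+1 = x * a k.+1 by rewrite /b ltnn.
have ak : 0 < a k.+1 by apply: apos.
have b0 : b 0%N = 1 by rewrite ba.
have bpos i : (i <= k.+1)%N -> 0 < b i.
  rewrite leq_eqVlt => /orP[/eqP ->|ik]; first by rewrite bk mulr_gt0.
  by rewrite ba // apos // ltnW.
have seck : sec b k = sec a k by apply: eq_sec.
have sF : (1 < size (sec a k * 'X)%R)%N.
  by rewrite size_mulX -?size_poly_eq0 size_sec // a0 oner_eq0.
have hF : hyperbolic (sec a k * 'X).
  by apply/hyperbolicM; split; [exact: ah | exact: hyperbolicX].
have hFa : hyperbolic (sec a k * 'X + (a k.+1)%:P) by rewrite -secS; exact: ah.
have bk01 : 0 < b k.+1 < a k.+1.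
  by rewrite bpos //= bk gtr_pMl.
have hb : hyperbolic (sec b k.+1).
  by rewrite secS seck; apply: hyperbolic_between hFa bk01.
have sb : sections_hyperbolic k.+1 b.
  split=> // i; rewrite leq_eqVlt => /orP[/eqP -> //|ik].
  rewrite (@eq_sec b a); first by apply: ah; exact: ltnW.
  by move=> l li; apply: ba; exact: leq_trans li ik.
exists b; split=> //.
(* the roots of the shrunk section are simple and negative *)
have [s E] := hyperbolic_split (hyperbolic_neq0 hb) hb.
have [mb szb] := Pol_sec k.+1 b0.
rewrite (monicP mb) scale1r in E.
have ss : size s = k.+1 by move: szb; rewrite E size_prod_XsubC => -[].
have us : uniq s.
  apply: split_poly_simple => c; rewrite -E secS seck => rc.
  by apply: simple_between hFa bk01 rc.
have [r rs|t alt t0] := @split_alternates _ s 0 us.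
  apply: (@coef_gt0_root_lt0 _ (sec b k.+1) k.+1) => //.
    by move=> d dk; rewrite coef_sec // bpos // leq_subr.
  by rewrite E root_prod_XsubC.
by exists t => //; rewrite E -ss.
Qed.

Lemma sections_hyperbolic_extend k a m : sections_hyperbolic k a ->
  (exists2 t, alternates k (sec a k) t & t 0%N < 0) ->
  exists2 b, sections_hyperbolic (k + m) b & forall i, (i <= k)%N -> b i = a i.
Proof.
move=> ha alta.
suff [b [h1 h2 _]] : exists b, [/\ sections_hyperbolic (k + m) b,
    forall i, (i <= k)%N -> b i = a i &
    exists2 t, alternates (k + m) (sec b (k + m)) t & t 0%N < 0] by exists b.
elim: m => [|m [b [[b0 bpos bh] ba [t alt t0]]]].
  by exists a; rewrite addn0; split.
have [e e0 [t' alt' t0']] := alternates_extend alt t0.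
pose c i := if (i <= k + m)%N then b i else e.
have cb i : (i <= k + m)%N -> c i = b i by rewrite /c => ->.
have ce : c (k + m).+1 = e by rewrite /c ltnn.
have sc : sec c (k + m).+1 = sec b (k + m) * 'X + e%:P.
  by rewrite secS ce (@eq_sec c b).
have c0 : c 0%N = 1 by rewrite cb.
exists c; rewrite addnS; split.
- split=> // i; rewrite leq_eqVlt => /orP[/eqP ->|ik].
  + by rewrite ce.
  + by rewrite cb // bpos.
  + rewrite sc; apply: alternates_hyperbolic alt'.
    by rewrite -sc size_sec // c0 oner_eq0.
  + rewrite (@eq_sec c b); first exact: bh.
    by move=> l li; apply: cb; exact: leq_trans li ik.
- by move=> i ik; rewrite cb ?ba // (leq_trans ik) // leq_addr.
- by exists t' => //; rewrite sc.
Qed.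

(** The infimum of the i-th ratio over [Delta R k] does not depend on k > i. *)
Lemma Delta_ratio_lt k P i x n : Delta R k P -> (0 < i < k)%N -> (i < n)%N ->
  coef_ratio k P i < x -> exists2 Q, Delta R n Q & coef_ratio n Q i < x.
Proof.
move=> DP /andP[i0 ik] hin rx; have [a0 apos ah] := Delta_acoef DP.
set a := acoef k P in a0 apos ah.
have ap : 0 < a i.-1 by apply: apos; rewrite (leq_trans (leq_pred _)) // ltnW.
have an : 0 < a i.+1 by apply: apos.
have ai : 0 < a i by apply: apos; exact: ltnW.
have rx' : a i ^+ 2 / (a i.-1 * a i.+1) < x by [].
have r0 : 0 < a i ^+ 2 / (a i.-1 * a i.+1).
  by rewrite divr_gt0 ?exprn_gt0 // mulr_gt0.
set r := a i ^+ 2 / _ in rx' r0.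
have x0 : 0 < x := lt_trans r0 rx'.
have rx1 : r / x < 1 by rewrite ltr_pdivrMr // mul1r.
have rx0 : 0 < r / x by rewrite divr_gt0.
(* shrinking by u divides the ratio r by u, and r / u < x *)
pose u := (r / x + 1) / 2.
have u01 : 0 < u < 1 by rewrite /u; apply/andP; split; lra.
have ur : r / x < u by rewrite /u; lra.
have ha : sections_hyperbolic i.+1 a.
  split=> // j ji; first by apply: apos; exact: leq_trans ji ik.
  by apply: ah; exact: leq_trans ji ik.
have [b [hb ba bi altb]] := sections_hyperbolic_shrink ha u01.
have [c hc cb] := sections_hyperbolic_extend (n - i.+1) hb altb.
rewrite subnKC // in hc.
exists (sec c n); first exact: Delta_sec.
rewrite /coef_ratio !acoef_sec //; last 2 first.
- by rewrite (leq_trans (leq_pred _)) // ltnW.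
- exact: ltnW.
rewrite !cb // ?bi ?(ba i.-1) ?(ba i) ?leq_pred //; last first.
- by rewrite leqW // leq_pred.
- have /andP[u0 _] := u01.
  have -> : a i ^+ 2 / (a i.-1 * (u * a i.+1)) = r / u.
    by rewrite /r; field; rewrite !gt_eqF.
  by rewrite ltr_pdivrMr // mulrC -ltr_pdivrMr.
Qed.

Lemma two_sided_Delta n P : two_sided R n P -> Delta R n P.
Proof.
move=> [PP Ppos Ph]; split=> // i /andP[_ hi]; apply: Ph.
by rewrite leq_subr leqnn.
Qed.

Lemma poscoef_coef n P : Pol n P -> poscoef n P ->
  forall d, (d <= n)%N -> 0 < P`_d.
Proof.
move=> PP Ppos d dn; rewrite (acoef_coef _ dn).
have [nd|nd] := posnP (n - d); first by rewrite nd acoef0.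
by apply: Ppos; rewrite nd leq_subr.
Qed.

Lemma Delta_Sigma n P : Delta R n P -> Sigma R n P.
Proof.
move=> DP; have [a0 apos ah] := Delta_acoef DP.
have [PP Ppos _] := DP; have [mP sP] := PP.
split=> //; first by rewrite -(@sec_acoef n P) ?sP //; apply: ah.
by move=> x; apply: (@coef_gt0_root_lt0 _ _ n) => //; apply: poscoef_coef.
Qed.

Lemma Sigma_poscoef n P : Sigma R n P -> poscoef n P.
Proof.
move=> [[mP sP] hP rP] i /andP[i0 hi].
by apply: (root_lt0_coef_gt0 sP _ hP rP); rewrite ?(monicP mP) ?leq_subr.
Qed.

Lemma newton_gt0 n i : (0 < i < n)%N -> 0 < newton R n i.
Proof.
move=> /andP[i0 hi].
by rewrite divr_gt0 // ltr0n muln_gt0 ?addn1 //= subn_gt0 hi.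
Qed.

Lemma coef_ratio_gt0 n P i : Pol n P -> poscoef n P -> (0 < i < n)%N ->
  0 < coef_ratio n P i.
Proof.
move=> PP Ppos /andP[i0 hi]; have Pd := poscoef_coef PP Ppos.
by rewrite divr_gt0 ?exprn_gt0 ?mulr_gt0 // Pd ?leq_subr.
Qed.

Lemma Sigma_newton n P i : Sigma R n P -> (0 < i < n)%N ->
  newton R n i <= coef_ratio n P i.
Proof.
move=> SP /andP[i0 hi]; have [PP hP rP] := SP; have [mP sP] := PP.
have Pd := poscoef_coef PP (Sigma_poscoef SP).
have hj : ((n - i.+1).+2 <= n)%N by move: hi i0; clear; lia.
have := @newton_ineq R P n (n - i.+1) hj _ Pd hP; rewrite sP => /(_ (leqnn _)).
have -> : (n - (n - i.+1) = i.+1)%N by move: hi i0; clear; lia.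
have -> : (n - (n - i.+1).+1 = i)%N by move: hi i0; clear; lia.
have -> : ((n - i.+1).+1 = n - i)%N by move: hi i0; clear; lia.
have -> : ((n - i).+1 = n - i.-1)%N by move: hi i0; clear; lia.
move=> h; rewrite /newton /coef_ratio /acoef.
rewrite ler_pdivrMr; last by rewrite ltr0n muln_gt0 subn_gt0 hi.
rewrite mulrAC ler_pdivlMr; last by rewrite mulr_gt0 // Pd ?leq_subr.
rewrite [leRHS]mulrC [((n - i) * i)%N]mulnC.
have -> : ((n - i + 1) * (i + 1) = i.+1 * (n - i.-1))%N.
  by move: hi i0; clear; nia.
by rewrite [P`_(n - i.-1) * _]mulrC.
Qed.

Lemma newton_ge1 n i : (0 < i < n)%N -> 1 <= newton R n i.
Proof.
move=> /andP[i0 hi]; rewrite /newton ler_pdivlMr.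
  by rewrite mul1r ler_nat leq_mul // leq_addr.
by rewrite ltr0n muln_gt0 subn_gt0 hi.
Qed.

Lemma binomial_Sigma n : Sigma R n (('X + 1) ^+ n).
Proof.
have -> : 'X + 1 = 'X - (-1)%:P :> {poly R} by rewrite rmorphN opprK.
have E : ('X - (-1)%:P) ^+ n = split_poly (nseq n (-1 : R)).
  by rewrite /split_poly big_nseq -iter_mulr_1.
split.
- split; first by rewrite rpredX // monicXsubC.
  by rewrite E size_prod_XsubC size_nseq.
- by rewrite E -[split_poly _]scale1r; apply: split_hyperbolic; rewrite oner_eq0.
- move=> x; rewrite E root_prod_XsubC => /nseqP[-> _].
  by rewrite oppr_lt0.
Qed.

Lemma binomial_newton n i : (0 < i < n)%N ->
  coef_ratio n (('X + 1) ^+ n) i = newton R n i.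
Proof.
move=> /andP[i0 hi].
have C k : (k <= n)%N -> acoef n (('X + 1) ^+ n : {poly R}) k = 'C(n, k)%:R.
  move=> kn; rewrite /acoef exprDn coef_sum.
  have kn' : (k < n.+1)%N by [].
  rewrite (bigD1 (Ordinal kn')) //= big1 ?addr0 => [|[j jn] /= ji].
    by rewrite expr1n mulr1 coefMn coefXn eqxx.
  rewrite expr1n mulr1 coefMn coefXn; case: eqP => [e|_]; last by rewrite mul0rn.
  by case/eqP: ji; apply: val_inj => /=; move: e jn kn; clear; lia.
have pos k : (k <= n)%N -> 'C(n, k)%:R != 0 :> R.
  by move=> kn; rewrite pnatr_eq0 -lt0n bin_gt0.
case: i i0 hi => [//|i] _ hi /=.
have i1 : (i <= n)%N by rewrite ltnW // ltnW.
rewrite /coef_ratio /newton !C //=; last exact: ltnW.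
have e1 : i.+1%:R * 'C(n, i.+1)%:R = (n - i)%:R * 'C(n, i)%:R :> R.
  by rewrite -!natrM mul_bin_left.
have e2 : i.+2%:R * 'C(n, i.+2)%:R = (n - i.+1)%:R * 'C(n, i.+1)%:R :> R.
  by rewrite -!natrM mul_bin_left.
apply/eqP; rewrite eqr_div; last 2 first.
- by rewrite mulf_neq0 // pos.
- by rewrite pnatr_eq0 -lt0n muln_gt0 subn_gt0 hi.
apply/eqP; have -> : (n - i.+1 + 1 = n - i)%N by move: hi; clear; lia.
rewrite addn1 !natrM.
transitivity (('C(n, i.+1)%:R * i.+1%:R) * ((n - i.+1)%:R * 'C(n, i.+1)%:R) : R).
  by ring.
rewrite -e2 [X in X * _]mulrC e1; ring.
Qed.
End Sections.

(** * Cones of coefficient ratios *)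

Section Cones.
Variable R : realType.
Implicit Types (P Q : {poly R}) (n i j k : nat) (c f : nat -> R).

(** The logarithm of the i-th coefficient ratio, as a linear form in the
    logarithms of the coefficients. *)
Definition concavity n (x : 'rV[R]_n) i : R :=
  2 * logcoord x i - logcoord x i.-1 - logcoord x i.+1.

(** The vector of coordinates f 1, ..., f n; meant for f 0 = 0. *)
Definition rowvec n f : 'rV[R]_n := \row_(j < n) f j.+1.

Lemma logcoordS n (x : 'rV[R]_n) (j : 'I_n) : logcoord x j.+1 = x 0 j.
Proof. by rewrite /logcoord /= valK. Qed.

Lemma logcoord_rowvec n f i : f 0%N = 0 -> (i <= n)%N ->
  logcoord (rowvec n f) i = f i.
Proof.
case: i => [//|i] f0 hi; by have := logcoordS (rowvec n f) (Ordinal hi); rewrite mxE.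
Qed.

Lemma logcoordD n (x y : 'rV[R]_n) i :
  logcoord (x + y) i = logcoord x i + logcoord y i.
Proof.
case: i => [|i] /=; first by rewrite addr0.
by case: insub => [j|] /=; rewrite ?mxE ?addr0.
Qed.

Lemma logcoordZ n t (x : 'rV[R]_n) i : logcoord (t *: x) i = t * logcoord x i.
Proof.
case: i => [|i] /=; first by rewrite mulr0.
by case: insub => [j|] /=; rewrite ?mxE ?mulr0.
Qed.

Lemma concavityD n (x y : 'rV[R]_n) i :
  concavity (x + y) i = concavity x i + concavity y i.
Proof. by rewrite /concavity !logcoordD; ring. Qed.

Lemma concavityZ n t (x : 'rV[R]_n) i : concavity (t *: x) i = t * concavity x i.
Proof. by rewrite /concavity !logcoordZ; ring. Qed.

Lemma concavityB n (x y : 'rV[R]_n) i :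
  concavity (x - y) i = concavity x i - concavity y i.
Proof. by rewrite -scaleN1r concavityD concavityZ mulN1r. Qed.

Lemma concavity_sum n (x : 'rV[R]_n) i :
  concavity x i = \sum_(j < n) concavity (delta_mx 0 j) i * x 0 j.
Proof.
rewrite {1}[x]row_sum_delta.
have h (s : seq 'I_n) : concavity (\sum_(j <- s) x 0 j *: delta_mx 0 j) i =
    \sum_(j <- s) concavity (delta_mx 0 j) i * x 0 j.
  elim: s => [|j s IH].
    by rewrite !big_nil -(scale0r (0 : 'rV[R]_n)) concavityZ mul0r.
  by rewrite !big_cons concavityD concavityZ IH mulrC.
exact: h.
Qed.

Lemma logcoord_logvec n P i : Pol n P -> (i <= n)%N ->
  logcoord (logvec n P) i = ln (acoef n P i).
Proof.
move=> PP hi; rewrite [logvec n P](_ : _ = rowvec n (fun j => ln (acoef n P j))).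
  by rewrite logcoord_rowvec // acoef0 // ln1.
by [].
Qed.

Lemma concavity_logvec n P i : Pol n P -> poscoef n P -> (0 < i < n)%N ->
  concavity (logvec n P) i = ln (coef_ratio n P i).
Proof.
move=> PP Ppos /andP[i0 hi]; have Pd := poscoef_coef PP Ppos.
have pos j : 0 < acoef n P j by rewrite /acoef Pd ?leq_subr.
have hi1 := ltnW hi; have hi' := leq_trans (leq_pred i) hi1.
rewrite /concavity !logcoord_logvec //.
rewrite /coef_ratio ln_div ?posrE ?mulr_gt0 ?exprn_gt0 //.
by rewrite lnM ?posrE // lnXn // mulr2n; ring.
Qed.

Lemma ratio_cone_logvec n c P : Pol n P -> poscoef n P ->
  (forall i, (0 < i < n)%N -> 0 < c i <= coef_ratio n P i) ->
  ratio_cone c (logvec n P).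
Proof.
move=> PP Ppos h i hi; have /andP[c0 ci] := h i hi.
rewrite -/(concavity _ _) concavity_logvec //.
by rewrite ler_ln // posrE // coef_ratio_gt0.
Qed.

(** The coefficient sequence whose logarithms are the coordinates of [x]. *)
Definition expvec n (x : 'rV[R]_n) i : R := expR (logcoord x i).

Lemma expvec0 n (x : 'rV[R]_n) : expvec x 0 = 1.
Proof. by rewrite /expvec /= expR0. Qed.

Lemma expvec_gt0 n (x : 'rV[R]_n) i : 0 < expvec x i.
Proof. exact: expR_gt0. Qed.

Lemma logvec_sec n (x : 'rV[R]_n) : logvec n (sec (expvec x) n) = x.
Proof.
apply/rowP => j; rewrite mxE acoef_sec; last exact: ltn_ord.
by rewrite /expvec logcoordS expRK.
Qed.

Lemma concavity_expvec n (x : 'rV[R]_n) i :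
  expR (concavity x i) = expvec x i ^+ 2 / (expvec x i.-1 * expvec x i.+1).
Proof.
by rewrite /concavity !expRB expRM_natl invfM mulrA.
Qed.

Lemma second_difference_solution (g : nat -> R) :
  exists2 f : nat -> R, f 0%N = 0 & forall i, (0 < i)%N -> 2 * f i - f i.-1 - f i.+1 = g i.
Proof.
pose s j := - \sum_(l < j) g l.+1.
exists (fun k => \sum_(j < k) s j); first by rewrite big_ord0.
move=> [//|i] _ /=; rewrite !big_ord_recr /=.
have -> : s i.+1 = s i - g i.+1 by rewrite /s big_ord_recr /= opprD.
ring.
Qed.

(** Existence of an apex for [ratio_cone c]. *)
Lemma apexP n c : exists w : 'rV[R]_n,
  forall i, (0 < i < n)%N -> concavity w i = ln (c i).
Proof.
have [f f0 fE] := second_difference_solution (fun i => ln (c i)).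
exists (rowvec n f) => i /andP[i0 hi].
have hi1 := ltnW hi; have hi' := leq_trans (leq_pred i) hi1.
by rewrite /concavity !logcoord_rowvec ?fE.
Qed.

Lemma ratio_cone_polyhedral n c : polyhedral_cone (ratio_cone c : set 'rV[R]_n).
Proof.
have [w wE] := apexP n c.
exists n.-1, (\matrix_(k, j) concavity (delta_mx 0 j) k.+1), w.
have E (x : 'rV[R]_n) (k : 'I_n.-1) :
    ((\matrix_(k < n.-1, j < n) concavity (delta_mx 0 j : 'rV[R]_n) k.+1) *m (x - w)^T) k 0 =
    concavity x k.+1 - ln (c k.+1).
  have kn : (0 < k.+1 < n)%N by move: (ltn_ord k); clear; lia.
  rewrite -(wE _ kn) -concavityB concavity_sum mxE.
  by apply: eq_bigr => j _; rewrite !mxE.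
apply/seteqP; split=> x /=.
  move=> h k; rewrite E subr_ge0; apply: h.
  by move: (ltn_ord k); clear; lia.
move=> h [//|i] hi; have hi' : (i < n.-1)%N by move: hi; clear; lia.
by have := h (Ordinal hi'); rewrite E subr_ge0.
Qed.

Lemma ray_slope_ge0 (a b : R) : (forall t, 0 <= t -> 0 <= a + t * b) -> 0 <= b.
Proof.
move=> h; rewrite leNgt; apply/negP => b0.
have a0 : 0 <= a by have := h 0 (lexx _); rewrite mul0r addr0.
have t0 : 0 <= (a + 1) / - b by apply: divr_ge0; lra.
have := h _ t0.
have -> : (a + 1) / - b * b = - (a + 1).
  by field; rewrite lt_eqF.
lra.
Qed.

Section Polyhedral.
Variables (n m : nat) (A : 'M[R]_(m, n)) (v : 'rV[R]_n).
Let L (k : 'I_m) (x : 'rV[R]_n) : R := (A *m x^T) k 0.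

Lemma constraintD (k : 'I_m) x y : L k (x + y) = L k x + L k y.
Proof. by rewrite /L linearD mulmxDr mxE. Qed.

Lemma constraintZ (k : 'I_m) t x : L k (t *: x) = t * L k x.
Proof. by rewrite /L linearZ /= -scalemxAr mxE. Qed.

Let D : set 'rV[R]_n := [set x | forall k : 'I_m, 0 <= L k (x - v)].

(** The directions of [ratio_cone c] are directions of any polyhedral cone that
    contains it. *)
Lemma polyhedral_recession c : ratio_cone c `<=` D ->
  forall y, (forall i, (0 < i < n)%N -> 0 <= concavity y i) -> forall k : 'I_m, 0 <= L k y.
Proof.
move=> cD y y0 k; have [w wE] := apexP n c.
apply: (@ray_slope_ge0 (L k (w - v))) => t t0.
rewrite -constraintZ -constraintD addrAC; apply: (cD (w + t *: y)).
move=> i hi; rewrite -/(concavity _ _) concavityD concavityZ wE //.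
by rewrite lerDl mulr_ge0 // y0.
Qed.

(** Conversely for a polyhedral cone contained in [ratio_cone c]. *)
Lemma recession_concave c : D `<=` ratio_cone c ->
  forall y, (forall k : 'I_m, 0 <= L k y) -> forall i, (0 < i < n)%N -> 0 <= concavity y i.
Proof.
move=> Dc y y0 i hi.
apply: (@ray_slope_ge0 (concavity v i - ln (c i))) => t t0.
have : D (v + t *: y).
  by move=> k; rewrite addrAC subrr add0r constraintZ mulr_ge0.
by move=> /Dc /(_ i hi); rewrite -/(concavity _ _) concavityD concavityZ; lra.
Qed.
End Polyhedral.

(** The ratios are approximated one at a time: a polyhedral cone has a single
    apex, so no simultaneous near-minimizer is needed. *)
Lemma minimal_ratio_cone n c (S : set 'rV[R]_n) :
  ratio_cone (fun=> 4) `<=` S -> S `<=` ratio_cone c ->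
  (forall i, (0 < i < n)%N -> 0 < c i) ->
  (forall i r, (0 < i < n)%N -> c i < r -> exists2 x, S x & concavity x i < ln r) ->
  minimal_cone_containing S (ratio_cone c).
Proof.
move=> c4S Sc c0 approx; split=> //; first exact: ratio_cone_polyhedral.
move=> _ [m [A [v ->]]] SD Dc; apply/seteqP; split=> // x xc k.
have L0 := polyhedral_recession (subset_trans c4S SD).
have q0 := recession_concave Dc.
apply: L0 => i hi; rewrite concavityB subr_ge0.
apply: le_trans (xc i hi).
rewrite leNgt; apply/negP => h.
(* otherwise some point of S has i-th ratio below that of the apex v *)
have hr : c i < expR (concavity v i).
  by rewrite -[c i]lnK ?posrE ?c0 // ltr_expR.
have [y yS yr] := approx i _ hi hr; rewrite expRK in yr.
have := q0 (y - v) _ i hi; rewrite concavityB subr_ge0 leNgt yr => /(_ _)/negP.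
by apply => //; exact: (SD y yS).
Qed.

Lemma maximal_hutchinson_cone n (S : set 'rV[R]_n) :
  ratio_cone (fun=> 4) `<=` S -> S `<=` logimage (Sigma R n) ->
  maximal_cone_in S (ratio_cone (fun=> 4)).
Proof.
move=> c4S SS; split=> //; first exact: ratio_cone_polyhedral.
move=> _ [m [A [v ->]]] DS c4D; apply/seteqP; split=> // x xD i /andP[i0 hi].
have L0 := polyhedral_recession c4D.
rewrite -/(concavity _ _) leNgt; apply/negP => qx.
(* in terms of degrees d = n - l, the terms of index i + 1, i, i - 1 have
   degrees e, e + 1, e + 2 *)
pose e := (n - i.+1)%N; pose w d := (e - d + (d - e.+2))%N.
pose a d := expvec x (n - d)%N.
have en : (e.+2 <= n)%N by move: i0 hi; rewrite /e; clear; lia.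
have disc : a e.+1 ^+ 2 < 4 * (a e * a e.+2).
  rewrite -ltr_pdivrMr ?mulr_gt0 ?expvec_gt0 // /a.
  have -> : (n - e = i.+1)%N by move: i0 hi; rewrite /e; clear; lia.
  have -> : (n - e.+1 = i)%N by move: i0 hi; rewrite /e; clear; lia.
  have -> : (n - e.+2 = i.-1)%N by move: i0 hi; rewrite /e; clear; lia.
  rewrite mulrC [_ * expvec x i.-1]mulrC mulrC -concavity_expvec.
  by rewrite -[4]lnK ?posrE // ltr_expR.
have [eta /andP[eta0 eta1]] :=
  @damped_not_hyperbolic R n e a en (fun d _ => expvec_gt0 x _) disc.
apply.
(* f l is normalized by f 0 = 0, as the leading coefficient stays 1 *)
pose f l : R := ln eta * (w (n - l)%N)%:R - ln eta * (w n)%:R.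
have f0 : f 0%N = 0 by rewrite /f subn0 subrr.
pose y := rowvec n f.
have y0 j : (0 < j < n)%N -> 0 <= concavity y j.
  move=> /andP[j0 hj]; have hj1 := ltnW hj; have hj' := leq_trans (leq_pred j) hj1.
  rewrite /concavity !logcoord_rowvec // /f.
  have : (w (n - j) * 2 <= w (n - j.-1) + w (n - j.+1))%N.
    by move: j0 hj; rewrite /w; clear; lia.
  rewrite -(ler_nat R) natrM natrD.
  have : ln eta <= 0 by rewrite ln_le0 // ltW.
  nra.
have /DS/SS[P PS PE] : [set x | forall k : 'I_m, 0 <= (A *m (x - v)^T) k 0] (x + y).
  move=> k; rewrite addrAC constraintD; apply: addr_ge0; first exact: xD.
  exact: L0.
have [PP hP _] := PS; have [mP sP] := PP.
have Pd := poscoef_coef PP (Sigma_poscoef PS).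
have Pcoef d : (d <= n)%N -> eta ^+ w n * P`_d = a d * eta ^+ w d.
  move=> dn; have := logcoord_logvec PP (leq_subr d n).
  rewrite PE logcoordD logcoord_rowvec ?leq_subr // /f subKn //.
  rewrite /acoef subKn // => /(congr1 expR); rewrite [RHS]lnK ?posrE ?Pd // => <-.
  rewrite !expRD -/(expvec _ _) -/(a d).
  have lnE k : expR (ln eta * k%:R) = eta ^+ k.
    by rewrite expRM_natr lnK ?posrE.
  rewrite expRN !lnE mulrCA; congr (_ * _).
  by rewrite mulrC divfK // expf_neq0 // gt_eqF.
rewrite (_ : \poly_(d < n.+1) _ = eta ^+ w n *: P).
  by apply/hyperbolicZ => //; rewrite expf_neq0 // gt_eqF.
apply/polyP => d; rewrite coef_poly coefZ; case: ltnP => dn.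
  by rewrite Pcoef.
by rewrite nth_default ?mulr0 // sP.
Qed.

Lemma two_sided_ratio_cone n :
  ratio_cone (fun=> 4) = logimage (two_sided R n) :> set 'rV[R]_n.
Proof.
apply/seteqP; split=> x /=.
  move=> xc; exists (sec (expvec x) n); last exact: logvec_sec.
  have a0 := expvec_gt0 x.
  split; first by apply: Pol_sec; exact: expvec0.
    by move=> i /andP[_ hi]; rewrite acoef_sec.
  move=> j k /andP[jk kn]; rewrite segment_poly //; apply/hyperbolicXnM.
  apply: hyperbolic_hutchinson => d dk.
    by rewrite coef_sec //; move: dk jk kn; clear; lia.
  rewrite !coef_sec; try by move: dk jk kn; clear; lia.
  pose i := (n - (j + d.+1))%N.
  have hi : (0 < i < n)%N by move: dk jk kn; rewrite /i; clear; lia.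
  have -> : (n - (j + d) = i.+1)%N by move: dk jk kn; rewrite /i; clear; lia.
  have -> : (n - (j + d.+2) = i.-1)%N by move: dk jk kn; rewrite /i; clear; lia.
  rewrite -/i -ler_pdivlMr ?mulr_gt0 // [expvec x i.+1 * _]mulrC.
  rewrite -concavity_expvec -[4]lnK ?posrE // ler_expR.
  exact: xc.
move=> [P PT <-]; have [PP Ppos Ph] := PT.
apply: ratio_cone_logvec => // i /andP[i0 hi]; rewrite ltr0n /=.
have Pd := poscoef_coef PP Ppos.
have ai k : 0 < acoef n P k by rewrite Pd ?leq_subr.
rewrite /coef_ratio ler_pdivlMr ?mulr_gt0 //.
rewrite leNgt; apply/negP => disc.
rewrite [acoef n P i.-1 * _]mulrC in disc.
have [z z0 zE] := quadratic_nonreal_root (ai i.-1) disc.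
have hjk : (n - i.+1 <= n - i.-1 <= n)%N.
  by rewrite leq_subr andbT; move: i0; clear; lia.
have := Ph _ _ hjk; rewrite segment_poly; last by case/andP: hjk.
move=> /hyperbolicXnM hQ; case/eqP: z0; apply: hQ.
rewrite /root (@horner_coef_wide _ 3); last first.
  rewrite size_map_poly (leq_trans (size_poly _ _)) //.
  by move: i0 hi; clear; lia.
rewrite !big_ord_recl big_ord0 !coef_map !coef_poly /=.
have -> : (n - i.-1 - (n - i.+1) = 2)%N by move: i0 hi; clear; lia.
rewrite /= /bump /= !addn0 ?add1n.
have -> : (n - i.+1 + 1 = n - i)%N by move: i0 hi; clear; lia.
have -> : (n - i.+1 + 2 = n - i.-1)%N by move: i0 hi; clear; lia.
by rewrite expr0 mulr1 expr1 addr0 addrA; apply/eqP; exact: zE.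
Qed.

(** The lower bound 1, which follows from Newton's inequalities, makes the
    logarithm of [petrovitch R i] meaningful. *)
Lemma petrovitch_le n P i : Delta R n P -> (0 < i < n)%N ->
  1 <= petrovitch R i <= coef_ratio n P i.
Proof.
move=> DP /andP[i0 hi].
have lb : lbound [set r | exists k Q, [/\ (i < k)%N, Delta R k Q & r = coef_ratio k Q i]] 1.
  move=> _ [k [Q [ik DQ ->]]].
  have hik : (0 < i < k)%N by rewrite i0.
  by apply: le_trans (newton_ge1 R hik) (Sigma_newton (Delta_Sigma DQ) hik).
apply/andP; split.
  apply: lb_le_inf => //; exists (coef_ratio n P i).
  by exists n, P.
apply: ge_inf; first by exists 1.
by exists n, P.
Qed.

End Cones.

Theorem proposition6 (R : realType) (n : nat) :
  (ratio_cone (fun=> 4) = logimage (two_sided R n) :> set 'rV[R]_n /\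
   maximal_cone_in (logimage (Delta R n)) (ratio_cone (fun=> 4) : set 'rV[R]_n) /\
   maximal_cone_in (logimage (Sigma R n)) (ratio_cone (fun=> 4) : set 'rV[R]_n)) /\
  (minimal_cone_containing (logimage (Delta R n))
     (ratio_cone (petrovitch R) : set 'rV[R]_n) /\
   minimal_cone_containing (logimage (Sigma R n))
     (ratio_cone (newton R n) : set 'rV[R]_n)).
Proof.
have TD : (ratio_cone (fun=> 4) : set 'rV[R]_n) `<=` logimage (Delta R n).
  rewrite two_sided_ratio_cone => _ [P PT <-].
  by exists P => //; exact: two_sided_Delta.
have DS : (logimage (Delta R n) : set 'rV[R]_n) `<=` logimage (Sigma R n).
  by move=> _ [P DP <-]; exists P => //; exact: Delta_Sigma.
have TS := subset_trans TD DS.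
have [w wE] := apexP n (fun=> 4 : R).
(* Delta R n is nonempty: it contains a polynomial whose log-image is the
   apex of Hutchinson's cone *)
have [P0 DP0 _] : logimage (Delta R n) w.
  by apply: TD => i hi; rewrite -/(concavity _ _) wE.
split; [split; first exact: two_sided_ratio_cone|]; split.
- exact: maximal_hutchinson_cone.
- exact: maximal_hutchinson_cone.
- apply: minimal_ratio_cone => //.
  + move=> _ [P DP <-]; have [PP Ppos _] := DP.
    apply: ratio_cone_logvec => // i hi.
    have /andP[h1 ->] := petrovitch_le DP hi.
    by rewrite (lt_le_trans ltr01 h1).
  + move=> i hi; have /andP[h1 _] := petrovitch_le DP0 hi.
    exact: lt_le_trans ltr01 h1.
  + move=> i r hi hr.
    have [_ [k [P [ik DP ->]]] Pr] :
        exists2 s, [set r | exists k Q, [/\ (i < k)%N, Delta R k Q & r = coef_ratio k Q i]] s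
        & s < r.
      apply: inf_lt hr; exists (coef_ratio n P0 i).
      by exists n, P0; split=> //; case/andP: hi.
    have [i0 hin] := andP hi.
    have [|Q DQ Qr] := Delta_ratio_lt DP _ hin Pr; first by rewrite i0.
    exists (logvec n Q); first by exists Q.
    have [QQ Qpos _] := DQ.
    rewrite concavity_logvec // ltr_ln // posrE ?coef_ratio_gt0 //.
    by apply: lt_trans Qr; exact: coef_ratio_gt0.
- apply: minimal_ratio_cone => //.
  + move=> _ [P SP <-]; have [PP _ _] := SP.
    apply: ratio_cone_logvec => // [|i hi]; first exact: Sigma_poscoef.
    by rewrite newton_gt0 // Sigma_newton.
  + exact: newton_gt0.
  + move=> i r hi hr; have BS := binomial_Sigma R n; have [PP _ _] := BS.
    exists (logvec n (('X + 1) ^+ n)); first by exists (('X + 1) ^+ n).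
    rewrite concavity_logvec //; last exact: Sigma_poscoef.
    rewrite binomial_newton // ltr_ln // posrE ?newton_gt0 //.
    by apply: lt_trans hr; exact: newton_gt0.
Qed.
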